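(* Let $r\ge 3$ be an integer and let $n\ge r+2$ be an integer. Let $\mathcal{H}$ be an $r$-graph on $n$ vertices, and let $|\mathcal{H}|$ denote its number of edges. (1) If $|\mathcal{H}| \ge \binom{n-1}{r}$, then $\mathcal{H}$ contains a Hamiltonian Berge path unless $\mathcal{H}\cong K_{n-1}^r+v$. (2) If $|\mathcal{H}| > \binom{n-1}{r}$, then $\mathcal{H}$ contains a Hamiltonian Berge cycle unless $\mathcal{H} \cong K_{n-1}^r + e$.
   Context: An $r$-graph ($r$-uniform hypergraph) $\mathcal{H}$ on $n$ vertices is a pair $(V,\mathcal{E})$ with $|V|=n$ and $\mathcal{E}\subseteq\binom{V}{r}$, where $\binom{V}{r}$ is the set of $r$-element subsets of $V$; elements of $\mathcal{E}$ are called edges. A Berge cycle of length $\ell$ in an $r$-graph is a list of $\ell$ distinct edges $e_1,\dots,e_\ell$ and $\ell$ distinct vertices $v_1,\dots,v_\ell$ such that $v_i\in e_i\cap e_{i+1}$ for $1\le i\le \ell-1$ and $v_\ell\in e_\ell\cap e_1$. A Berge path of length $\ell$ is the structure obtained from a Berge cycle of length $\ell$ by deleting one of the edges; that is, it consists of $\ell$ distinct vertices $v_1,\dots,v_\ell$ and $\ell-1$ distinct edges $e_1,\dots,e_{\ell-1}$ with $\{v_i,v_{i+1}\}\subseteq e_i$ for $1\le i\le \ell-1$. A Hamiltonian Berge cycle (resp. Hamiltonian Berge path) is a Berge cycle (resp. Berge path) whose vertices $v_1,\dots,v_\ell$ are all the vertices of the $r$-graph (so $\ell=n$). The complete $r$-graph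 $K_{m}^r$ on $m$ vertices has as edges all $r$-element subsets of its vertex set. $K_{n-1}^r+v$ denotes the $n$-vertex $r$-graph that is the disjoint union of $K_{n-1}^r$ and an isolated vertex $v$. $K_{n-1}^r+e$ denotes $K_{n-1}^r+v$ together with one additional edge $e$ containing $v$. The symbol $\cong$ denotes isomorphism of hypergraphs. *)

(* Defs.v *)
From mathcomp Require Import all_boot.

Set Implicit Arguments.
Unset Strict Implicit.
Unset Printing Implicit Defensive.

Record hypergraph (r : nat) (V : finType) := Hypergraph {
  edges : {set {set V}};
  edges_uniform : forall e : {set V}, e \in edges -> #|e| = r
}.

(* Lists of l vertices or edges are maps from 'I_l, so that v_1, ..., v_l are
   indexed from 0; ordS is the cyclic successor, so that the last vertex lies in
   the last and the first edge. *)
Definition berge_cycle r V (H : hypergraph r V) l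
    (v : 'I_l -> V) (e : 'I_l -> {set V}) : Prop :=
  [/\ injective v, injective e, forall i, e i \in edges H
    & forall i, v i \in e i :&: e (ordS i)].

(* The length of a path is its number l of vertices, not of edges. *)
Definition berge_path r V (H : hypergraph r V) l
    (v : 'I_l -> V) (e : 'I_l.-1 -> {set V}) : Prop :=
  [/\ injective v, injective e, forall i, e i \in edges H
    & forall (i : 'I_l.-1) (j k : 'I_l), j = i :> nat -> k = i.+1 :> nat ->
        [set v j; v k] \subset e i].

Definition has_hamiltonian_berge_cycle r V (H : hypergraph r V) : Prop :=
  exists (l : nat) (v : 'I_l -> V) (e : 'I_l -> {set V}),
    berge_cycle H v e /\ forall x : V, exists i, v i = x.

Definition has_hamiltonian_berge_path r V (H : hypergraph r V) : Prop :=
  exists (l : nat) (v : 'I_l -> V) (e : 'I_l.-1 -> {set V}),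
    berge_path H v e /\ forall x : V, exists i, v i = x.

Definition hypergraph_iso r (V W : finType)
    (G : hypergraph r V) (H : hypergraph r W) : Prop :=
  exists2 f : V -> W, bijective f
    & forall A : {set V}, (A \in edges G) = (f @: A \in edges H).

Lemma complete_uniform r (V : finType) (e : {set V}) :
  e \in [set A : {set V} | #|A| == r] -> #|e| = r.
Proof. by rewrite inE => /eqP. Qed.

Definition complete r V : hypergraph r V := Hypergraph (@complete_uniform r V).

Lemma add_vertex_uniform r V (G : hypergraph r V) (e : {set option V}) :
  e \in [set Some @: (A : {set V}) | A in edges G] -> #|e| = r.
Proof.
case/imsetP=> A AG ->; rewrite card_imset; first exact: edges_uniform AG.
by move=> x y [].
Qed.

(* The isolated new vertex is None. *)
Definition add_vertex r V (G : hypergraph r V) : hypergraph r (option V) :=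
  Hypergraph (@add_vertex_uniform r V G).

Lemma add_edge_uniform r (V : finType) (G : hypergraph r V) (e : {set V}) :
  #|e| = r -> forall A, A \in e |: edges G -> #|A| = r.
Proof. by move=> er A /setU1P[->|/edges_uniform]. Qed.

Definition add_edge r V (G : hypergraph r V) (e : {set V}) (er : #|e| = r) :
    hypergraph r V := Hypergraph (@add_edge_uniform r V G e er).

Definition is_complete_plus_vertex r V (H : hypergraph r V) m : Prop :=
  hypergraph_iso H (add_vertex (complete r 'I_m)).

(* All choices of an r-set e through the new vertex give isomorphic r-graphs. *)
Definition is_complete_plus_edge r V (H : hypergraph r V) m : Prop :=
  exists (e : {set option 'I_m}) (er : #|e| = r),
    None \in e /\ hypergraph_iso H (add_edge (add_vertex (complete r 'I_m)) er).

(* Main.v *)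
Require Import Defs.
From mathcomp Require Import all_boot perm zify.
Set Implicit Arguments.
Unset Strict Implicit.
Unset Printing Implicit Defensive.

(** Both parts rest on one statement, ham_dense: if 3 <= r and r + 2 <= |X|, if E is a set of more than
    C(|X|-1, r) r-subsets of X, and if every vertex lies in at least two edges, then there is a Hamiltonian
    Berge cycle. For part (2), a vertex x in at most one edge leaves C(|X|-1, r) possible edges avoiding x,
    so all of these are present together with exactly one edge through x: this is the exception. Part (1)
    follows by adding a suitable non-edge g to the hypergraph and opening the resulting cycle at g.

    The proof of ham_dense is by induction on |X|. When |X| >= r + 3, averaging gives a vertex v such that
    more than C(|X|-2, r) + 1 edges avoid v (exists_deletion); these edges have minimum degree two
    automatically, hence a Hamiltonian cycle on the remaining vertices. Either v can be inserted between two
    consecutive vertices (insertion), or two edges f, g through v and a free edge h allow a Posa rotation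
    (crossing). That one of the two happens is a counting matter (ham_delete): if v has degree d and cannot
    be inserted, then at least |X| - 1 + d sets are candidates for h (separated_count), while at most d - 1
    of them are missing from E and at most |X| - 1 of them are used by the cycle.

    When |X| = r + 2 the edges are the complements of the edges of a graph with |X| edges, and a different
    induction is used (base_step). The link of a vertex v is of the same kind with |X| and r both smaller by
    one; if it has a Hamiltonian cycle, all edges of this cycle extend through v, and one further edge
    suffices to place v itself (ham_of_link). A suitable v exists unless the graph of complements is
    2-regular. In that case (ham_regular) the link is completed by a virtual edge, and the cycle is closed at
    v in its place with the help of the two edges avoiding v. The induction starts from five
    vertices, where all systems of triples are searched by computation (ham_five). *)

(** * Hamiltonian Berge cycles as cycles of the incidence graph *)

Section Cycles.
Variable V : finType.
Implicit Types (x y v : V) (e f g h : {set V}) (X : {set V}) (E : {set {set V}}).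

(** Working in this bipartite graph makes a Berge cycle an ordinary duplicate-free cycle: vertices and edges
    alternate by themselves, distinctness of both is one uniq, and reversing a segment is rev_path. *)
Definition incident (a b : V + {set V}) : bool :=
  match a, b with
  | inl x, inr e => x \in e
  | inr e, inl x => x \in e
  | _, _ => false
  end.

Lemma incidentC : symmetric incident.
Proof. by case=> [x|e] [y|f]. Qed.

(** The part of being a Hamiltonian Berge cycle that does not depend on the order of the items. It survives
    permutations, so a rerouted cycle only has to be compared with the old one by counting. *)
Definition spans X E (s : seq (V + {set V})) : Prop :=
  [/\ uniq s, forall x, (inl x \in s) = (x \in X) & forall e, inr e \in s -> e \in E].

Lemma spans_perm X E s t : perm_eq s t -> spans X E s -> spans X E t.
Proof.
move=> st [us Xs Es]; split=> [|x|e]; rewrite -?(perm_uniq st) -?(perm_mem st) //; exact: Es.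
Qed.

Lemma spans_vertex X E s v : v \notin X -> spans X E s -> spans (v |: X) E (inl v :: s).
Proof.
move=> vX [us Xs Es]; split=> [|x|e]; first by rewrite /= us Xs vX.
  by rewrite inE in_setU1 Xs.
by rewrite inE /=; apply: Es.
Qed.

Lemma spans_edge X E s e : e \in E -> inr e \notin s -> spans X E s -> spans X E (inr e :: s).
Proof.
move=> eE es [us Xs Es]; split=> [|x|f]; first by rewrite /= us es.
  by rewrite inE /= Xs.
by rewrite inE => /orP[/eqP[->] //|/Es].
Qed.

Lemma spans_behead X E s e : spans X E (inr e :: s) -> spans X E s.
Proof.
case=> /andP[_ us] Xs Es; split=> // f fs.
by apply: Es; rewrite inE fs orbT.
Qed.

Definition ham_cycle X E (s : seq (V + {set V})) : Prop :=
  cycle incident s /\ spans X E s.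

Definition hamiltonian X E : Prop := exists s, ham_cycle X E s.

Lemma ham_cycle_rot X E s i : ham_cycle X E s -> ham_cycle X E (rot i s).
Proof.
case=> cs sp; split; first by rewrite rot_cycle.
by apply: spans_perm sp; rewrite perm_sym perm_rot.
Qed.

Lemma hamiltonianS X E E' : E \subset E' -> hamiltonian X E -> hamiltonian X E'.
Proof. by move=> /subsetP sE [s [? [? ? Es]]]; exists s; split=> //; split=> // e /Es /sE. Qed.

(** The defaults set0 and x are never met on a Hamiltonian cycle: there the successor of a vertex is an
    edge and the successor of an edge is a vertex. *)
Definition next_edge s x : {set V} := if next s (inl x) is inr e then e else set0.

Definition next_vertex s x : V := if next s (inr (next_edge s x)) is inl y then y else x.

Section Successor.
Variables (X : {set V}) (E : {set {set V}}) (s : seq (V + {set V})).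
Hypothesis sH : ham_cycle X E s.

Lemma nextP x : x \in X -> next s (inl x) = inr (next_edge s x) /\ next s (inr (next_edge s x)) = inl (next_vertex s x).
Proof.
case: sH => cs [us Xs Es]; rewrite -Xs => xs.
have e1 : next s (inl x) = inr (next_edge s x).
  by have := next_cycle cs xs; rewrite /next_edge; case: next.
split=> //.
have : (inr (next_edge s x)) \in s by rewrite -e1 mem_next.
by move/(next_cycle cs); rewrite /next_vertex; case: next.
Qed.

Lemma next_edge_in x : x \in X -> next_edge s x \in E.
Proof. by case: sH => _ [_ Xs Es] xX; apply: Es; case/nextP: (xX) => <- _; rewrite mem_next Xs. Qed.

Lemma next_vertex_in x : x \in X -> next_vertex s x \in X.
Proof.
by case: sH => _ [_ Xs _] xX; rewrite -Xs; case/nextP: (xX) => e1 <-; rewrite mem_next -e1 mem_next Xs.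
Qed.

Lemma next_vertex_inj : {in X &, injective (next_vertex s)}.
Proof.
case: sH => _ [us _ _] x y xX yX eq_xy.
have [e1 e2] := nextP xX; have [e3 e4] := nextP yX.
have : (inl x : V + {set V}) = inl y; last by case.
by apply: (can_inj (prev_next us)); apply: (can_inj (prev_next us)); rewrite e1 e3 e2 e4 eq_xy.
Qed.

Lemma edge_next_edge e : inr e \in s -> exists2 x, x \in X & e = next_edge s x.
Proof.
case: sH => cs [us Xs _] es.
have := prev_cycle cs es; case eqp: (prev s (inr e)) => [x|//] _.
have xX : x \in X by rewrite -Xs -eqp mem_prev.
exists x => //.
have [] := nextP xX; rewrite -eqp next_prev //; by case.
Qed.

(** A cyclic permutation has a single orbit. Membership in A is followed along the cycle by a predicate
    on both kinds of items, an edge being accepted when the vertex after it lies in A. *)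
Lemma next_vertex_closed (A : {set V}) : A \subset X -> A != set0 ->
  (forall x, x \in A -> next_vertex s x \in A) -> A = X.
Proof.
case: (sH) => cs [us Xs _] /subsetP AX /set0Pn[x0 x0A] Acl.
pose Q (z : V + {set V}) := match z with inl x => x \in A | inr _ => if next s z is inl y then y \in A else false end.
have Qn z : Q z -> Q (next s z).
  case: z => [x|e] /=; last by case: next.
  by move=> xA; have [-> /= ->] := nextP (AX _ xA); apply: Acl.
have x0s : inl x0 \in s by rewrite Xs AX.
have [i p def_s] := rot_to x0s.
have: fcycle (next s) (inl x0 :: p) by rewrite -def_s rot_cycle cycle_next.
rewrite /= rcons_path => /andP[pp _].
have Qp : all Q p.
  have: Q (inl x0) by [].
  elim: p (inl x0 : V + {set V}) pp {def_s} => //= b p IH a /andP[/eqP <- pp] Qa.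
  by rewrite Qn //= (IH (next s a)) // Qn.
apply/setP=> x; apply/idP/idP; first exact: AX.
rewrite -Xs -(mem_rot i) def_s inE => /orP[/eqP[->] //|].
by move/(allP Qp).
Qed.

Lemma next_head i a t : rot i s = a :: t -> head a t = next s a.
Proof.
case: sH => _ [us _ _] ri.
by rewrite -(next_rot i us) ri; case: t {ri} => [|b t] /=; rewrite eqxx.
Qed.

Lemma rot_vertex x : x \in X -> exists i t, rot i s = inl x :: inr (next_edge s x) :: t.
Proof.
move=> xX; have [e1 _] := nextP xX.
have xs : inl x \in s by case: sH => _ [_ -> _].
have [i t def_s] := rot_to xs; have := next_head def_s; rewrite e1.
by case: t def_s => [//|b t] def_s /= eb; exists i, t; rewrite def_s eb.
Qed.

Lemma next_vertex_head i x t : x \in X -> rot i s = inl x :: inr (next_edge s x) :: t ->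
  head (inl x) t = inl (next_vertex s x).
Proof.
move=> xX ri; have [e1 e2] := nextP xX.
have ri' : rot 1 (rot i s) = inr (next_edge s x) :: rcons t (inl x).
  by rewrite ri rot1_cons.
have us : uniq s by case: sH => _ [].
move: e2; rewrite -(next_rot i us) -(next_rot 1 (p := rot i s)) ?rot_uniq //.
by rewrite ri'; case: t {ri ri'} => [|b t] /=; rewrite eqxx.
Qed.

End Successor.

Lemma next_edge_inj X E s x y : ham_cycle X E s -> x \in X -> y \in X ->
  next_edge s x = next_edge s y -> x = y.
Proof.
move=> sH xX yX eq_e; have [_ [us _ _]] := sH.
have [e1 _] := nextP sH xX; have [e2 _] := nextP sH yX.
have : (inl x : V + {set V}) = inl y; last by case.
by apply: (can_inj (prev_next us)); rewrite e1 e2 eq_e.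
Qed.

Lemma next_incident X E s x : ham_cycle X E s -> x \in X ->
  x \in next_edge s x /\ next_vertex s x \in next_edge s x.
Proof.
move=> sH xX; have [e1 e2] := nextP sH xX; have [cs [_ Xs _]] := sH.
have xs : inl x \in s by rewrite Xs.
have := next_cycle cs xs; rewrite e1 /= => ->; split=> //.
have es : inr (next_edge s x) \in s by rewrite -e1 mem_next.
by have := next_cycle cs es; rewrite e2.
Qed.

(** Otherwise the first k iterates would form a proper closed subset. *)
Lemma no_short_cycle X E s k x : ham_cycle X E s -> x \in X -> 0 < k < #|X| -> iter k (next_vertex s) x != x.
Proof.
move=> sH xX /andP[k0 kX]; apply/negP=> /eqP e.
pose A := [set y in traject (next_vertex s) x k].
have : A = X.
  apply: (next_vertex_closed sH).
  - apply/subsetP=> y; rewrite inE => /trajectP[i _ ->].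
    by elim: i => //= i IH; apply: next_vertex_in sH _ _.
  - by apply/set0Pn; exists x; rewrite inE; apply/trajectP; exists 0.
  - move=> y; rewrite !inE => /trajectP[i ik ->].
    have [ik1|ik1] := ltnP i.+1 k; apply/trajectP; first by exists i.+1.
    have ek : i.+1 = k by clear -ik ik1; lia.
    by exists 0 => //; rewrite -iterS ek.
move/(congr1 (fun B : {set V} => #|B|)) => cA.
have : #|A| <= k by rewrite cardsE (leq_trans (card_size _)) ?size_traject.
rewrite cA; clear -kX; lia.
Qed.

Lemma next_vertex_pre X E s y : ham_cycle X E s -> y \in X -> exists2 x, x \in X & next_vertex s x = y.
Proof.
move=> sH yX.
have : next_vertex s @: X = X.
  apply/eqP; rewrite eqEcard; apply/andP; split.
    by apply/subsetP=> _ /imsetP[x xX ->]; apply: next_vertex_in sH _ _.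
  by rewrite card_in_imset // => x z xX zX; apply: next_vertex_inj sH _ _ _ _.
by move/setP/(_ y); rewrite yX => /imsetP[x xX ->]; exists x.
Qed.

Lemma card_used X E s : ham_cycle X E s -> #|[set next_edge s x | x in X]| = #|X|.
Proof. by move=> sH; rewrite card_in_imset // => x y xX yX; apply: next_edge_inj sH _ _. Qed.

Lemma path_start (T : Type) (r : rel T) a b c t : path r a (rcons t b) -> r c (head b t) -> path r c (rcons t b).
Proof. by case: t => [|d t] /= => [_ ->|/andP[_ ->] ->]. Qed.

Lemma inr_neq e e' : e != e' -> (inr e : V + {set V}) != inr e'.
Proof. by apply: contraNneq => -[->]. Qed.

(** * Rerouting a cycle *)

(** The edge between x and its successor is replaced by f, v, g. *)
Lemma insertion X E s x v f g : ham_cycle X E s -> x \in X -> v \notin X -> f != g ->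
  inr f \notin s -> inr g \notin s -> f \in E -> g \in E ->
  v \in f -> v \in g -> x \in f -> next_vertex s x \in g -> hamiltonian (v |: X) E.
Proof.
move=> sH xX vX fg fs gs fE gE vf vg xf yg.
have [i [t def_s]] := rot_vertex sH xX.
have [cs sp] := ham_cycle_rot i sH; rewrite def_s in cs sp.
have hd := next_vertex_head sH xX def_s.
move: fs gs; rewrite -!(mem_rot i s) def_s !inE !negb_or /= => /andP[_ ft] /andP[_ gt].
exists (inl x :: inr f :: inl v :: inr g :: t); split.
  rewrite /= xf vf vg /=; have /andP[_ pt] := cs.
  by rewrite (path_start pt) // hd.
apply: (@spans_perm _ _ (inl v :: inr f :: inr g :: inl x :: t)).
  by apply/seq.permP=> P /=; clear; lia.
apply: (spans_vertex vX); apply: (spans_edge fE).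
  by rewrite in_cons negb_or (inr_neq fg) in_cons.
apply: (spans_edge gE); first by rewrite in_cons.
apply: (@spans_behead _ _ _ (next_edge s x)); apply: spans_perm sp.
by apply/seq.permP=> P /=; clear; lia.
Qed.

(** The rotation of Posa: start at v, take f to x, run backwards from x to the successor of y, jump through
    h to the successor of x, run forwards to y and return through g. The edges that followed x and y are released. *)
Lemma crossing X E s x y v f g h : ham_cycle X E s -> x \in X -> y \in X -> x != y -> v \notin X ->
  f != g -> inr f \notin s -> inr g \notin s -> inr h \notin s -> f \in E -> g \in E -> h \in E ->
  v \in f -> v \in g -> v \notin h -> x \in f -> y \in g ->
  next_vertex s x \in h -> next_vertex s y \in h -> hamiltonian (v |: X) E.
Proof.
move=> sH xX yX xy vX fg fs gs hs fE gE hE vf vg vh xf yg sxh syh.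
have fh : f != h by apply: contraNneq vh => <-.
have gh : g != h by apply: contraNneq vh => <-.
have [i [t def_s]] := rot_vertex sH xX.
have [cs sp] := ham_cycle_rot i sH; rewrite def_s in cs sp.
have hd := next_vertex_head sH xX def_s.
have yt : inl y \in t.
  have [_ Xs _] := sp.
  by have := Xs y; rewrite yX !inE /= => /orP[/eqP[eyx]|//]; rewrite eyx eqxx in xy.
case/splitPr: yt => t1 t2 in def_s cs sp hd.
have us : uniq s by case: sH => _ [].
have [e1 e2] := nextP sH yX.
pose s' := rot (size (inl x :: inr (next_edge s x) :: t1)) (rot i s).
have def_s' : s' = inl y :: t2 ++ inl x :: inr (next_edge s x) :: t1.
  by rewrite /s' def_s -cat_cons -cat_cons rot_size_cat.
have nx : next s' =1 next s by move=> z; rewrite !next_rot ?rot_uniq.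
have {s' nx def_s'} [t3 def_t2] : exists t3, t2 = inr (next_edge s y) :: t3 /\ head (inl x) t3 = inl (next_vertex s y).
  have us' : uniq s' by rewrite !rot_uniq.
  move: (nx (inl y)); rewrite e1 def_s'.
  case: t2 {def_s cs sp hd} def_s' => [|b t3] /= def_s'; rewrite eqxx // => eb.
  exists t3; split; first by rewrite eb.
  move: (nx (inr (next_edge s y))); rewrite e2 -(next_rot 1 us') def_s' eb rot1_cons.
  by case: t3 {def_s'} => [|c t3] /=; rewrite eqxx.
case: def_t2 => ? hd3; subst t2.
have cover : perm_eq (inl v :: inr f :: inr g :: inr h :: inl x :: t1 ++ inl y :: t3)
   (inl v :: inr f :: inl x :: rev t3 ++ inr h :: t1 ++ [:: inl y; inr g]).
  by apply/seq.permP=> P; rewrite /= !count_cat /= count_rev count_cat /=; clear; lia.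
have notin e : inr e \notin s -> inr e \notin inl x :: t1 ++ inl y :: t3.
  rewrite -(mem_rot i s) def_s; apply: contra.
  by rewrite !(inE, mem_cat) /= => /orP[->|->]; rewrite !orbT.
exists (inl v :: inr f :: inl x :: rev t3 ++ inr h :: t1 ++ [:: inl y; inr g]); split; last first.
  apply: (spans_perm cover); apply: (spans_vertex vX).
  apply: (spans_edge fE).
    by rewrite 2!(in_cons (inr _)) 2!negb_or (inr_neq fg) (inr_neq fh) (notin _ fs).
  apply: (spans_edge gE); first by rewrite in_cons negb_or (inr_neq gh) (notin _ gs).
  apply: (spans_edge hE); first exact: notin.
  apply: (@spans_behead _ _ _ (next_edge s x)); apply: (@spans_behead _ _ _ (next_edge s y)).
  by apply: spans_perm sp; apply/seq.permP=> P; rewrite /= !count_cat /=; clear; lia.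
move: cs; rewrite /= vf xf /= !rcons_cat /= !cat_path /= => /and3P[xc p1 /and3P[yc' cy p3]].
have last3 : last (inl x) (rev t3) = inl (next_vertex s y).
  by rewrite -hd3; case: (t3) => [|a u] //=; rewrite rev_cons last_rcons.
apply/and3P; split.
- have := rev_path incident (inr (next_edge s y)) (rcons t3 (inl x)).
  rewrite last_rcons belast_rcons rev_cons rcons_path.
  rewrite (eq_path (e' := incident)); last by move=> a b; rewrite /= incidentC.
  by rewrite p3 => /andP[].
- by rewrite last3.
have: path incident (inr h) (rcons t1 (inl y)).
  apply: (@path_start _ _ (inr (next_edge s x))); first by rewrite rcons_path p1.
  by move: hd; case: (t1) => [|a u] /= => [[->]|->].
by rewrite rcons_path last_cat cat_path -cats1 cat_path /= => /and3P[-> -> _]; rewrite yg vg.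
Qed.

Definition relabel (t : {set V} -> {set V}) (z : V + {set V}) : V + {set V} :=
  match z with inl x => inl x | inr e => inr (t e) end.

(** Edges of a cycle may be exchanged for other sets as long as each new set still contains both
    neighbours of the old one on the cycle and distinct edges stay distinct. *)
Lemma ham_cycle_relabel X E E' s (t : {set V} -> {set V}) : ham_cycle X E s ->
  (forall x, x \in X -> x \in t (next_edge s x) /\ next_vertex s x \in t (next_edge s x)) ->
  (forall x, x \in X -> t (next_edge s x) \in E') ->
  (forall x y, x \in X -> y \in X -> t (next_edge s x) = t (next_edge s y) -> next_edge s x = next_edge s y) ->
  ham_cycle X E' (map (relabel t) s).
Proof.
move=> sH inc tE tinj; have [cs [us Xs Es]] := sH.
split.
  rewrite cycle_map.
  apply: (@sub_in_cycle _ (mem s) (frel (next s))); last 2 first.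
  - exact/allP.
  - exact: cycle_next.
  move=> a b /= az bz /eqP <- {b bz}.
  case: a az => [x xs|e es] /=.
    have xX : x \in X by rewrite -Xs.
    have [-> _] := nextP sH xX; by have [] := inc _ xX.
  have [x xX def_e] := edge_next_edge sH es.
  have [_ ] := nextP sH xX; rewrite -def_e => -> /=.
  by rewrite def_e; have [] := inc _ xX.
split.
- rewrite map_inj_in_uniq // => -[x|e] [y|f] //= es fs [].
  have [x xX ->] := edge_next_edge sH es; have [y yX ->] := edge_next_edge sH fs.
  by move=> /(tinj _ _ xX yX) ->.
- move=> x; rewrite -Xs; apply/mapP/idP => [[[y|e] // ys [->]] //|xs].
  by exists (inl x).
- move=> e /mapP[[//|f] fs [->]].
  by have [x xX ->] := edge_next_edge sH fs; apply: tE.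
Qed.

End Cycles.

(** * Stars and links in uniform hypergraphs *)

Lemma leq_bin n k : 0 < k < n -> n <= 'C(n, k).
Proof.
elim: n k => [|n IH] [|k] //= kn; rewrite binS.
have [->|k0] := posnP k; first by rewrite bin0 bin1 addn1.
have [<-|nk] := eqVneq k.+1 n; first by rewrite binn binSn.
have : n <= 'C(n, k.+1) by apply: IH; lia.
have : 0 < 'C(n, k) by rewrite bin_gt0; lia.
lia.
Qed.

Lemma leq_add_mul a b : 1 < a -> 1 < b -> a + b <= a * b.
Proof. nia. Qed.

Section Uniform.
Variable V : finType.
Implicit Types (x y v : V) (X : {set V}) (E : {set {set V}}) (e g : {set V}).

Definition rsets X r : {set {set V}} := [set T : {set V} | (T \subset X) && (#|T| == r)].

Lemma card_rsets X r : #|rsets X r| = 'C(#|X|, r).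
Proof. exact: cards_draws. Qed.

(** Removing x is a bijection onto the k-subsets of X without x. *)
Lemma card_rsets_at X k x : x \in X -> #|[set T in rsets X k.+1 | x \in T]| = 'C(#|X|.-1, k).
Proof.
move=> xX; have -> : #|X|.-1 = #|X :\ x| by rewrite (cardsD1 x X) xX.
have inj : {in rsets (X :\ x) k &, injective (fun T => x |: T)}.
  move=> B C; rewrite !inE !subsetD1 => /andP[/andP[_ xB] _] /andP[/andP[_ xC] _].
  by move=> /(congr1 (fun A => A :\ x)); rewrite !setU1K.
rewrite -card_rsets -(card_in_imset inj); apply: eq_card => T; rewrite !inE.
apply/idP/imsetP => [/andP[/andP[TX /eqP cT] xT]|[B]].
  exists (T :\ x); last by rewrite setD1K.
  by rewrite inE setSD //=; have := cardsD1 x T; rewrite xT cT => -[->].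
rewrite !inE subsetD1 => /andP[/andP[BX xB] /eqP cB] ->.
by rewrite subUset sub1set xX BX cardsU1 xB cB setU11 eqxx.
Qed.

Lemma card_rsets_le X E r : E \subset rsets X r -> #|E| <= 'C(#|X|, r).
Proof. by move/subset_leq_card; rewrite card_rsets. Qed.

Lemma mem_rsets X r E e : E \subset rsets X r -> e \in E -> e \subset X /\ #|e| = r.
Proof. by move=> /subsetP EX /EX; rewrite inE => /andP[-> /eqP]. Qed.

Definition star E x : {set {set V}} := [set e in E | x \in e].

Definition avoiding E x : {set {set V}} := [set e in E | x \notin e].

Lemma card_star_avoiding E x : #|star E x| + #|avoiding E x| = #|E|.
Proof.
by rewrite -(cardsID [set e : {set V} | x \in e] E); congr (_ + _); apply: eq_card => e; rewrite !inE // andbC.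
Qed.

Lemma star_sub E E' x : E \subset E' -> #|star E x| <= #|star E' x|.
Proof.
by move=> /subsetP s; apply: subset_leq_card; apply/subsetP=> e; rewrite !inE => /andP[/s-> ->].
Qed.

Lemma avoiding_rsets X E r x : E \subset rsets X r -> avoiding E x \subset rsets (X :\ x) r.
Proof.
move=> /subsetP EX; apply/subsetP=> e; rewrite inE => /andP[/EX]; rewrite !inE subsetD1.
by case/andP=> -> -> ->.
Qed.

Lemma sum_avoiding X E r : E \subset rsets X r ->
  \sum_(x in X) #|avoiding E x| = #|E| * (#|X| - r).
Proof.
move=> /subsetP EX.
transitivity (\sum_(x in X) \sum_(e in E) (x \notin e : nat)).
  apply: eq_bigr => x _; rewrite -sum1_card big_mkcond [RHS]big_mkcond /=; apply: eq_bigr => e _.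
  by rewrite inE; case: (e \in E); case: (x \in e).
rewrite exchange_big -sum_nat_const; apply: eq_bigr => e /EX; rewrite inE => /andP[eX /eqP <-].
rewrite -[#|e|](_ : #|X :&: e| = _); last by rewrite (setIidPr eX).
rewrite -cardsD -sum1_card big_mkcond [RHS]big_mkcond /=; apply: eq_bigr => x _.
by rewrite inE; case: (x \in e); case: (x \in X).
Qed.

(** Edges avoiding x number at most C(|X|-1, r), so an excess of two forces two edges through x. *)
Lemma avoiding_mindeg X E r x : E \subset rsets X r -> x \in X -> 'C(#|X|.-1, r).+1 < #|E| -> 1 < #|star E x|.
Proof.
move=> EX xX cE; have := card_rsets_le (avoiding_rsets x EX).
have cX := cardsD1 x X; rewrite xX add1n in cX; have -> : #|X :\ x| = #|X|.-1 by rewrite cX.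
have := card_star_avoiding E x; clear -cE; lia.
Qed.

(** Only the set of all vertices other than x and y can occur. *)
Lemma card_avoiding2 X E x y : E \subset rsets X (#|X| - 2) -> x \in X -> y \in X -> x != y ->
  #|avoiding (avoiding E x) y| <= 1.
Proof.
move=> EX xX yX xy; apply: leq_trans (card_rsets_le (avoiding_rsets y (avoiding_rsets x EX))) _.
have -> : #|X :\ x :\ y| = #|X| - 2.
  have := cardsD1 x X; have := cardsD1 y (X :\ x); rewrite xX !inE eq_sym xy yX /= => -> ->.
  by rewrite addnA addKn.
by rewrite binn.
Qed.

Definition link E v : {set {set V}} := [set (e : {set V}) :\ v | e in star E v].

Lemma linkP E v (B : {set V}) : reflect (v \notin B /\ v |: B \in E) (B \in link E v).
Proof.
apply: (iffP imsetP) => [[e]|[vB BE]].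
  by rewrite inE => /andP[eE ve] ->; rewrite setD1K // !inE eqxx.
by exists (v |: B); rewrite ?setU1K // inE BE setU11.
Qed.

Lemma card_link E v : #|link E v| = #|star E v|.
Proof.
rewrite card_in_imset // => e g; rewrite !inE => /andP[_ ve] /andP[_ vg] /(congr1 (fun A : {set V} => v |: A)).
by rewrite !setD1K.
Qed.

Lemma link_rsets X E r v : v \in X -> E \subset rsets X r.+1 -> link E v \subset rsets (X :\ v) r.
Proof.
move=> vX /subsetP EX; apply/subsetP=> B /linkP[vB /EX].
by rewrite !inE subUset sub1set vX subsetD1 vB andbT cardsU1 vB add1n eqSS.
Qed.

Lemma card_star_link E v x : x != v -> #|star (star E v) x| <= #|star (link E v) x|.
Proof.
move=> xv.
have inj : {in star (star E v) x &, injective (fun e => e :\ v)}.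
  move=> e g; rewrite !inE => /andP[/andP[_ ve] _] /andP[/andP[_ vg] _] /(congr1 (fun A : {set V} => v |: A)).
  by rewrite !setD1K.
rewrite -(card_in_imset inj); apply: subset_leq_card; apply/subsetP=> _ /imsetP[e + ->].
rewrite !inE => /andP[/andP[eE ve] xe]; rewrite xv xe /= andbT.
by apply/linkP; rewrite setD1K // !inE eqxx.
Qed.

End Uniform.

(** * Counting separated sets *)

Section Count.
Variable V : finType.
Implicit Types (x y z : V) (B C T X : {set V}) (L : {set {set V}}).

(** With L the link of v, the free edges to which crossing applies are exactly the images of these sets under
    the successor map of the cycle. *)
Definition separated X r L : {set {set V}} :=
  [set T in rsets X r | [exists B in L, exists C in L, exists x in B :&: T, exists y in C :&: T,
     (B != C) && (x != y)]].

Lemma separatedI X r L T B C x y : T \in rsets X r -> B \in L -> C \in L -> B != C ->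
  x \in B -> y \in C -> x \in T -> y \in T -> x != y -> T \in separated X r L.
Proof.
move=> TX BL CL BC xB yC xT yT xy; rewrite inE TX.
apply/existsP; exists B; rewrite BL; apply/existsP; exists C; rewrite CL.
by apply/existsP; exists x; rewrite inE xB xT; apply/existsP; exists y; rewrite inE yC yT BC.
Qed.

Section CountCycle.
Variables (X : {set V}) (r : nat) (L : {set {set V}}) (f : V -> V).
Hypotheses (r3 : 2 < r) (Xr : r + 2 <= #|X|) (L2 : 1 < #|L|) (Lr : L \subset rsets X r.-1).
Hypothesis (f_inj : {in X &, injective f}) (fX : forall x, x \in X -> f x \in X).
Hypothesis f_closed : forall A : {set V}, A \subset X -> A != set0 ->
  (forall x, x \in A -> f x \in A) -> A = X.
Hypothesis far : forall B C x y, B \in L -> C \in L -> B != C -> x \in B -> y \in C -> f x != y.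

Let N := cover L.
Let O := X :\: N.

Lemma Lsub B : B \in L -> B \subset N.
Proof. exact: bigcup_sup. Qed.

Lemma LX B : B \in L -> B \subset X.
Proof. by move/(subsetP Lr); rewrite inE => /andP[]. Qed.

Lemma Lcard B : B \in L -> #|B| = r.-1.
Proof. by move/(subsetP Lr); rewrite inE => /andP[_ /eqP]. Qed.

Lemma NX : N \subset X.
Proof. by apply/bigcupsP=> B /LX. Qed.

Lemma cardNO : #|N| + #|O| = #|X|.
Proof. by have := cardsID N X; rewrite (setIidPr NX). Qed.

(** Through this the count uses that f is a single cycle: each part of the covered vertices has an exit. *)
Lemma f_leaves (A : {set V}) : A \subset X -> A != set0 -> #|A| < #|X| -> exists2 x, x \in A & f x \notin A.
Proof.
move=> AX A0 lAX; apply/exists_inP; apply: contraLR lAX; rewrite negb_exists_in -leqNgt.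
move=> /forall_inP cl; rewrite (f_closed AX A0) // => x /cl.
by rewrite negbK.
Qed.

Lemma f_neq x : x \in X -> f x != x.
Proof.
move=> xX; apply/negP=> /eqP e; have : [set x] = X.
  by apply: f_closed; rewrite ?sub1set // -?card_gt0 ?cards1 // => z /set1P->; rewrite e set11.
by move/(congr1 (fun A : {set V} => #|A|)); rewrite cards1; lia.
Qed.

(** Let B0 be disjoint from the other members of L, let Y be the rest of the covered vertices and O the
    uncovered ones. Every x in B0 is separated from every y in Y, so two kinds of sets are counted: B0 with
    one element exchanged for y in Y, plus an element of O; and C with an element of B0 added, for the
    other C in L. Since f maps neither part into the other, it leaves each part to O, whence |O| >= 2, and
    the products outweigh |X| + |L|. *)
Lemma separated_count_isolated B0 : B0 \in L ->
  (forall C, C \in L -> C != B0 -> [disjoint B0 & C]) -> #|X| + #|L| <= #|separated X r L|.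
Proof.
move=> B0L iso.
set Y := N :\: B0.
have B0N := Lsub B0L.
have cY : #|B0| + #|Y| = #|N| by have := cardsID B0 N; rewrite (setIidPr B0N).
have YC y : y \in Y -> exists C, [/\ C \in L, C != B0 & y \in C].
  case/setDP=> /bigcupP[C CL yC] yB0; exists C; split=> //.
  by apply: contraNneq yB0 => <-.
have [C0 C0L C0B0] : exists2 C, C \in L & C != B0.
  have : 0 < #|L :\ B0| by have := L2; rewrite (cardsD1 B0) B0L.
  by case/card_gt0P=> C /setD1P[]; exists C.
have disY C : C \in L -> C != B0 -> C \subset Y.
  move=> CL CB; rewrite subsetD Lsub //= disjoint_sym; exact: iso.
have cY2 : r.-1 <= #|Y| by rewrite -(Lcard C0L) subset_leq_card // disY.
have c0 := Lcard B0L.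
have cNO := cardNO.
have O2 : 1 < #|O|.
  have [x xB fxB] : exists2 x, x \in B0 & f x \notin B0.
    by apply: f_leaves; rewrite ?LX // -?card_gt0; lia.
  have [y yY fyY] : exists2 x, x \in Y & f x \notin Y.
    apply: f_leaves; rewrite -?card_gt0; [|lia..].
    by apply: subset_trans NX; apply: subsetDl.
  have [C [CL CB0 yC]] := YC y yY.
  have xX := subsetP (LX B0L) _ xB; have yX := subsetP (LX CL) _ yC.
  have fxO : f x \in O.
    rewrite inE fX // andbT; apply/negP => fxN.
    have : f x \in Y by rewrite inE fxB.
    case/YC=> D [DL DB fD].
    by have := far B0L DL; rewrite eq_sym DB => /(_ x (f x) isT xB fD); rewrite eqxx.
  have fyO : f y \in O.
    rewrite inE fX // andbT; apply/negP => fyN.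
    have fyB : f y \in B0 by apply: contraR fyY => fB; rewrite inE fB.
    by have := far CL B0L CB0 yC fyB; rewrite eqxx.
  have : [set f x; f y] \subset O by rewrite subUset !sub1set fxO.
  move/subset_leq_card; apply: leq_trans.
  rewrite cards2; have [/(f_inj xX yX) exy|//] := eqVneq.
  by move: yY; rewrite -exy inE xB.
have dis_BY x y : x \in B0 -> y \in Y -> x == y = false.
  by move=> xB /setDP[_ yB]; apply: contraNF yB => /eqP<-.
have dis_BO x t : x \in B0 -> t \in O -> x == t = false.
  by move=> /(subsetP B0N) xN /setDP[_ tN]; apply: contraNF tN => /eqP<-.
have dis_YO y t : y \in Y -> t \in O -> y != t.
  by move=> /setDP[yN _] /setDP[_ tN]; apply: contraNneq tN => <-.
have cB0 x : x \in B0 -> #|B0 :\ x| = r.-2 by move=> xB; have := cardsD1 x B0; rewrite xB c0; lia.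
have r1 : 0 < r.-1 by lia.
have r2 : 0 < r.-2 by lia.
have rS2 : r.-2.+2 = r by lia.
have rS1 : r.-1.+1 = r by lia.
pose T1 := [set u.2 |: (u.1.2 |: (B0 :\ u.1.1)) | u in setX (setX B0 Y) O].
pose T2 := [set u.2 |: u.1 | u in setX (L :\ B0) B0].
have c1 : #|T1| = #|B0| * #|Y| * #|O|.
  rewrite card_in_imset ?cardsX // => -[[x y] t] [[x' y'] t'] /=.
  rewrite !in_setX /= => /andP[/andP[xB yY] tO] /andP[/andP[xB' yY'] tO'] /setP eqT.
  have ex : x = x'.
    apply/eqP; apply: contraT => xx'.
    by have := eqT x; rewrite !inE eqxx (dis_BY _ _ xB yY) (dis_BO _ _ xB tO) (dis_BY _ _ xB yY') (dis_BO _ _ xB tO') xB xx'.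
  have ey : y = y'.
    apply/eqP; apply: contraT => yy'.
    have := eqT y; rewrite !inE eqxx orbT (negPf yy') (negPf (dis_YO _ _ yY tO')) /=.
    by move/setDP: yY => [_ /negPf->]; rewrite andbF.
  have et : t = t'.
    apply/eqP; apply: contraT => tt'.
    have := eqT t; rewrite !in_setU1 !in_setD1 eqxx (negPf tt') [t == y']eq_sym (negPf (dis_YO _ _ yY' tO)) /=.
    have/negPf-> : t \notin B0 by apply: contraTN tO => /(subsetP B0N); rewrite inE negb_and negbK => ->.
    by rewrite andbF.
  by rewrite ex ey et.
have c2 : #|T2| = (#|L| - 1) * #|B0|.
  rewrite card_in_imset ?cardsX; first by rewrite (cardsD1 B0 L) B0L addKn.
  case=> [C x] [C' x'] /=; rewrite !in_setX /= !in_setD1 => /andP[/andP[CB CL] xB] /andP[/andP[CB' CL'] xB'] /setP eqT.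
  have xC D z : D \in L -> D != B0 -> z \in B0 -> z \notin D.
    by move=> DL DB zB; have := iso D DL DB; rewrite disjoint_subset => /subsetP/(_ z zB).
  have ex : x = x'.
    by have := eqT x; rewrite !inE eqxx /= (negPf (xC _ _ CL' CB' xB)) orbF => /esym/eqP.
  rewrite -{x' xB'}ex in eqT *; congr pair; apply/setP=> z; have := eqT z; rewrite !inE.
  by have [->|//] := eqVneq; rewrite (negPf (xC _ _ CL CB xB)) (negPf (xC _ _ CL' CB' xB)).
have sW : T1 :|: T2 \subset separated X r L.
  apply/subsetP=> T; rewrite in_setU => /orP[] /imsetP.
    case=> -[[x y] t]; rewrite !in_setX /= => /andP[/andP[xB yY] tO] ->.
    have [C [CL CB0 yC]] := YC y yY.
    have /card_gt0P[z zB] : 0 < #|B0 :\ x| by rewrite cB0.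
    have zB0 : z \in B0 by move: zB => /setD1P[].
    apply: (@separatedI _ _ _ _ B0 C z y) => //.
    - rewrite inE !subUset !sub1set.
      have -> : t \in X by move/setDP: tO => [].
      have -> : y \in X by move/setDP: yY => [/(subsetP NX)].
      rewrite (subset_trans (subsetDl _ _) (LX B0L)) /= !cardsU1 !in_setU1 !in_setD1 [t == y]eq_sym.
      rewrite (negPf (dis_YO _ _ yY tO)) /=.
      have/negPf-> : t \notin B0 by apply: contraTN tO => /(subsetP B0N); rewrite inE negb_and negbK => ->.
      have/negPf-> : y \notin B0 by case/setDP: yY.
      by rewrite !andbF /= cB0 // !add1n rS2.
    - by rewrite eq_sym.
    - by rewrite in_setU in_setU1 zB !orbT.
    - by rewrite !inE eqxx orbT.
    - by rewrite (dis_BY _ _ zB0 yY).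
  case=> -[C x]; rewrite !in_setX /= in_setD1 => /andP[/andP[CB CL] xB] ->.
  have /card_gt0P[y yC] : 0 < #|C| by rewrite Lcard.
  have xC : x \notin C by have := iso C CL CB; rewrite disjoint_subset => /subsetP/(_ x xB).
  apply: (@separatedI _ _ _ _ B0 C x y) => //; last by apply: contraNneq xC => ->.
  - by rewrite inE subUset sub1set (subsetP (LX B0L)) // LX // cardsU1 xC Lcard // add1n rS1 eqxx.
  - by rewrite eq_sym.
  - by rewrite !inE eqxx.
  - by rewrite !inE yC orbT.
have dT : [disjoint T1 & T2].
  rewrite -setI_eq0; apply/eqP/setP=> T; rewrite in_setI in_set0; apply/negP=> /andP[].
  case/imsetP=> -[[x y] t]; rewrite !in_setX /= => /andP[_ /setDP[_ tN]] ->.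
  case/imsetP=> -[C z]; rewrite !in_setX /= in_setD1 => /andP[/andP[_ CL] zB] /setP/(_ t).
  rewrite !inE eqxx => /esym/orP[/eqP etz|/(subsetP (Lsub CL))]; last by rewrite (negPf tN).
  by rewrite etz (subsetP B0N) in tN.
move/subset_leq_card: sW; apply: leq_trans.
rewrite cardsU disjoint_setI0 // cards0 c1 c2 subn0 c0 -cardNO -cY c0.
have p2 : 1 < r.-1 by lia.
have pY := leq_add_mul p2 (leq_trans p2 cY2).
have pYO : r.-1 * #|Y| + #|O| <= r.-1 * #|Y| * #|O| by apply: leq_add_mul => //; lia.
have : (#|L| - 1) * 2 <= (#|L| - 1) * r.-1 by rewrite leq_mul2l p2 orbT.
lia.
Qed.

(** Now x0 lies in two members of L, so it is separated from all other covered vertices. Counted are: the sets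
    B + x0 for B in L avoiding x0; the sets D + t for D a covered (r-1)-set through x0 and t uncovered; and,
    to gain |X| - 3 more, the sets through x and y but not x0, where x and y are taken from the two
    set differences of the members meeting at x0. It remains to beat |L| by three, for which there must
    be at least three choices of D or at least three of t. *)
Lemma separated_count_meeting B1 B2 x0 : B1 \in L -> B2 \in L -> B1 != B2 ->
  x0 \in B1 -> x0 \in B2 -> #|X| + #|L| <= #|separated X r L|.
Proof.
move=> B1L B2L B12 x0B1 x0B2.
have c1 := Lcard B1L; have c2 := Lcard B2L; have cNO := cardNO.
have [x xB1 xB2] : exists2 x, x \in B1 & x \notin B2.
  by apply/subsetPn; apply: contra B12 => sB; rewrite eqEcard sB c1 c2 leqnn.
have [y yB2 yB1] : exists2 x, x \in B2 & x \notin B1.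
  by apply/subsetPn; apply: contra B12 => sB; rewrite eq_sym eqEcard sB c1 c2 leqnn.
have xx0 : x != x0 by apply: contraNneq xB2 => ->.
have yx0 : y != x0 by apply: contraNneq yB1 => ->.
have xy : x != y by apply: contraNneq yB1 => <-.
have x0N := subsetP (Lsub B1L) _ x0B1.
have xN := subsetP (Lsub B1L) _ xB1.
have yN := subsetP (Lsub B2L) _ yB2.
have N0X := NX; have XN := subsetP NX.
have NL z : z \in N -> exists C, [/\ C \in L & z \in C] by case/bigcupP=> C; exists C.
(* If z lies in B1, the pair is separated by B2 and B1, otherwise by B1 and a member through z. *)
have far0 z : z \in N -> z != x0 -> exists B C, [/\ B \in L, C \in L, B != C, x0 \in B & z \in C].
  case/NL=> C [CL zC] zx0; have [eC|CB1] := eqVneq B1 C; last by exists B1, C.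
  by exists B2, C; rewrite -eC eq_sym B12 eC.
have cN : r <= #|N|.
  have := subset_leq_card (_ : y |: B1 \subset N); rewrite cardsU1 yB1 c1.
  by rewrite subUset sub1set yN Lsub // => /(_ isT) h; clear -r3 h; lia.
have fx0O : f x0 \in O.
  rewrite inE fX ?XN // andbT; apply/negP => fN.
  have [B [C [BL CL BC xB fC]]] := far0 _ fN (f_neq (XN _ x0N)).
  by have := far BL CL BC xB fC; rewrite eqxx.
have O2 : 1 < #|O|.
  have [z /setD1P[zx0 zN] fz] : exists2 z, z \in N :\ x0 & f z \notin N :\ x0.
    have cD := cardsD1 x0 N; rewrite x0N in cD.
    apply: f_leaves; rewrite -?card_gt0; [|clear -r3 cN cD cNO; lia..].
    by apply: subset_trans NX; apply: subsetDl.
  have fzO : f z \in O.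
    rewrite inE fX ?XN // andbT; apply/negP => fN.
    have [B [C [BL CL BC xB zC]]] := far0 _ zN zx0.
    move: fz; rewrite !inE fN andbT negbK => /eqP fz.
    by have := far CL BL _ zC xB; rewrite eq_sym fz eqxx => /(_ BC).
  have : [set f x0; f z] \subset O by rewrite subUset !sub1set fx0O.
  move/subset_leq_card; apply: leq_trans.
  by rewrite cards2; have [/(f_inj (XN _ x0N) (XN _ zN)) e|//] := eqVneq; rewrite e eqxx in zx0.
have r1 : 0 < r.-1 by clear -r3; lia.
have rS1 : r.-1.+1 = r by clear -r3; lia.
pose D := [set A in rsets N r.-1 | x0 \in A].
pose L0 := [set B in L | x0 \in B].
pose L1 := [set B in L | x0 \notin B].
have L01 : #|L0| + #|L1| = #|L|.
  rewrite -(cardsID [set B : {set V} | x0 \in B] L); congr (_ + _); apply: eq_card => B; rewrite !inE andbC //.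
have L0_2 : 1 < #|L0|.
  have : [set B1; B2] \subset L0 by rewrite subUset !sub1set !inE B1L B2L x0B1.
  by move/subset_leq_card; rewrite cards2 B12.
have cD : #|D| = 'C(#|N|.-1, r - 2).
  by rewrite -(card_rsets_at (r - 2) x0N); have -> : (r - 2).+1 = r.-1 by clear -r3; lia.
have DL0 : #|L0| <= #|D|.
  apply: subset_leq_card; apply/subsetP=> B; rewrite !inE => /andP[BL ->].
  by rewrite Lsub // Lcard // eqxx.
have D2 : #|N|.-1 <= #|D| by rewrite cD; apply: leq_bin; clear -r3 cN; lia.
have big : 2 < #|D| \/ 2 < #|O|.
  have [N4|N4] := ltnP 3 #|N|; first by left; clear -D2 N4; lia.
  right; have eN : [set x0; x; y] = N.
    apply/eqP; rewrite eqEcard !subUset !sub1set x0N xN yN /=.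
    by rewrite setUC cardsU1 cards2 !inE negb_or yx0 [y == x]eq_sym xy [x0 == x]eq_sym xx0.
  have fNO z : z \in N -> f z \in O.
    move=> zN; rewrite inE fX ?XN // andbT; apply/negP => fzN; move: (zN) (fzN).
    have fz := f_neq (XN _ zN).
    have B21 : B2 != B1 by rewrite eq_sym.
    rewrite -{1 2}eN !inE -!orbA => /or3P[]/eqP ez /or3P[]/eqP efz; move: fz; rewrite efz ez ?eqxx //= => _.
    - by have := far B2L B1L B21 x0B2 xB1; rewrite -ez efz eqxx.
    - by have := far B1L B2L B12 x0B1 yB2; rewrite -ez efz eqxx.
    - by have := far B1L B2L B12 xB1 x0B2; rewrite -ez efz eqxx.
    - by have := far B1L B2L B12 xB1 yB2; rewrite -ez efz eqxx.
    - by have := far B2L B1L B21 yB2 x0B1; rewrite -ez efz eqxx.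
    - by have := far B2L B1L B21 yB2 xB1; rewrite -ez efz eqxx.
  have : f @: N \subset O by apply/subsetP=> _ /imsetP[z zN ->]; exact: fNO.
  move/subset_leq_card; rewrite card_in_imset; last by move=> u v /XN uX /XN vX; exact: f_inj.
  by apply: leq_trans; apply: leq_trans cN.
pose T1 := [set x0 |: B | B in L1].
pose T2 := [set u.2 |: u.1 | u in setX D O].
pose T3 := [set x |: (y |: S) | S in rsets (X :\: [set x0; x; y]) (r - 2)].
have t1 : #|T1| = #|L1|.
  rewrite card_in_imset // => B C; rewrite !inE => /andP[_ xB] /andP[_ xC] /(congr1 (fun A => A :\ x0)).
  by rewrite !setU1K.
have t2 : #|T2| = #|D| * #|O|.
  rewrite card_in_imset ?cardsX // => -[B t] [C u]; rewrite !in_setX /= !inE.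
  move=> /andP[/andP[/andP[BN _] _] /andP[tN _]] /andP[/andP[/andP[CN _] _] /andP[uN _]] eT.
  have : N :&: (t |: B) = N :&: (u |: C) by rewrite eT.
  have cap (A : {set V}) z : A \subset N -> z \notin N -> N :&: (z |: A) = A.
    move=> AN zN; apply/setP=> w; rewrite !inE; have [->|_] /= := eqVneq.
      by rewrite (negPf zN); apply/esym/negP => /(subsetP AN); rewrite (negPf zN).
    by apply: andb_idl; apply: (subsetP AN).
  rewrite !cap // => eB; rewrite -eB; congr pair.
  move/setP/(_ t): eT; rewrite !inE eqxx => /esym/orP[/eqP //|/(subsetP CN)].
  by rewrite (negPf tN).
have t3 : #|X| - 3 <= #|T3|.
  have cX : #|X :\: [set x0; x; y]| = #|X| - 3.
    rewrite cardsD (setIidPr _) ?subUset ?sub1set ?XN //.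
    by rewrite setUC cardsU1 cards2 !inE negb_or yx0 [y == x]eq_sym xy [x0 == x]eq_sym xx0.
  rewrite card_in_imset ?card_rsets ?cX; first by apply: leq_bin; clear -r3 Xr; lia.
  move=> S S'; rewrite !inE !subsetD => /andP[/andP[_ dS] _] /andP[/andP[_ dS'] _].
  have notin (A : {set V}) z : [disjoint A & [set x0; x; y]] -> z \in [set x0; x; y] -> z \notin A.
    by rewrite disjoint_sym disjoint_subset => /subsetP dA /dA.
  move=> /(congr1 (fun A : {set V} => (A :\ x) :\ y)); rewrite !setU1K ?setU1K //; try by apply: notin; rewrite // !inE eqxx ?orbT.
    by rewrite in_setU1 negb_or xy; apply: notin; rewrite // !inE eqxx ?orbT.
  by rewrite in_setU1 negb_or xy; apply: notin; rewrite // !inE eqxx ?orbT.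
have T12 : [disjoint T1 & T2].
  rewrite -setI_eq0; apply/eqP/setP=> T; rewrite in_setI in_set0; apply/negP=> /andP[].
  case/imsetP=> B; rewrite inE => /andP[BL _] ->.
  case/imsetP=> -[C t]; rewrite !in_setX /= => /andP[_ /setDP[_ tN]] /setP/(_ t).
  rewrite !inE eqxx => /orP[/eqP e|/(subsetP (Lsub BL))]; last by rewrite (negPf tN).
  by rewrite e x0N in tN.
have T123 : [disjoint T1 :|: T2 & T3].
  rewrite -setI_eq0; apply/eqP/setP=> T; rewrite in_setI in_set0; apply/negP=> /andP[T12' T3T].
  have : x0 \in T.
    case/setUP: T12' => /imsetP[]; first by move=> B _ ->; rewrite setU11.
    by case=> C t; rewrite !in_setX /= !inE => /andP[/andP[_ x0C] _] ->; rewrite !inE x0C orbT.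
  case/imsetP: T3T => S; rewrite !inE subsetD => /andP[/andP[_ dS] _] ->.
  rewrite !inE ![x0 == _]eq_sym (negPf xx0) (negPf yx0) /= => x0S.
  by move: dS; rewrite disjoint_subset => /subsetP/(_ x0 x0S); rewrite !inE eqxx.
have sW : T1 :|: T2 :|: T3 \subset separated X r L.
  apply/subsetP=> T /setUP[/setUP[]|] /imsetP[].
  - move=> B; rewrite inE => /andP[BL x0B] ->.
    have /card_gt0P[z zB] : 0 < #|B| by rewrite Lcard.
    apply: (@separatedI _ _ _ _ B1 B x0 z) => //.
    + by rewrite inE subUset sub1set XN // LX // cardsU1 x0B Lcard // add1n rS1 eqxx.
    + by apply: contraNneq x0B => <-.
    + by rewrite setU11.
    + by rewrite in_setU1 zB orbT.
    + by apply: contraNneq x0B => ->.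
  - case=> C t; rewrite in_setX /= => /andP[CD /setDP[tX tN]] ->.
    have /andP[/andP[CN /eqP cC] x0C] : (C \subset N) && (#|C| == r.-1) && (x0 \in C) by move: CD; rewrite !inE.
    have /card_gt0P[z /setD1P[zx0 zC]] : 0 < #|C :\ x0| by have := cardsD1 x0 C; rewrite x0C cC; clear -r3; lia.
    have [A [B [AL BL AB x0A zB]]] := far0 _ (subsetP CN _ zC) zx0.
    apply: (@separatedI _ _ _ _ A B x0 z) => //.
    + rewrite inE subUset sub1set tX (subset_trans CN NX) cardsU1 cC.
      have -> : t \notin C by apply: contra tN => /(subsetP CN).
      by rewrite add1n rS1 eqxx.
    + by rewrite in_setU1 x0C orbT.
    + by rewrite in_setU1 zC orbT.
    + by rewrite eq_sym.
  - move=> S SS ->.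
    have /andP[/andP[SX dS] /eqP cS] : (S \subset X) && [disjoint S & [set x0; x; y]] && (#|S| == r - 2).
      by move: SS; rewrite !inE subsetD.
    apply: (@separatedI _ _ _ _ B1 B2 x y) => //; last 2 first.
    + by rewrite setU11.
    + by rewrite !inE eqxx orbT.
    have notin z : z \in [set x0; x; y] -> z \notin S.
      by move: dS; rewrite disjoint_sym disjoint_subset => /subsetP dA /dA.
    rewrite inE !subUset !sub1set SX !XN // !cardsU1 !in_setU1 (negPf xy) /= cS.
    by rewrite !(negPf (notin _ _)) ?inE ?eqxx ?orbT //; apply/eqP; clear -r3; lia.
move/subset_leq_card: sW; apply: leq_trans.
rewrite cardsU disjoint_setI0 // cards0 cardsU disjoint_setI0 // cards0 t1 t2 !subn0.
have : #|D| * 2 <= #|D| * #|O| by rewrite leq_mul2l O2 orbT.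
move=> DO2; clear -big L01 L0_2 DL0 DO2 t3 O2 Xr r3.
by nia.
Qed.

(** The bound is tailored to ham_delete: the non-edges and the edges of the cycle are too few to account for
    that many sets. *)
Lemma separated_count : #|X| + #|L| <= #|separated X r L|.
Proof.
have [/exists_inP[B0 B0L /forall_inP iso]|] := boolP [exists B0 in L, [forall (C | C \in L :\ B0), [disjoint B0 & C]]].
  by apply: (separated_count_isolated B0L) => C CL CB; apply: iso; rewrite !inE CB.
rewrite negb_exists_in => /forall_inP nis.
have /card_gt0P[B BL] : 0 < #|L| by lia.
have := nis B BL; rewrite negb_forall_in => /exists_inP[C /setD1P[CB CL]].
rewrite -setI_eq0 => /set0Pn[x /setIP[xB xC]].
by apply: (separated_count_meeting BL CL _ xB xC); rewrite eq_sym.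
Qed.

End CountCycle.
End Count.

(** * Deleting a vertex *)

Section Deletion.
Variable V : finType.
Implicit Types (x y v : V) (X : {set V}) (E : {set {set V}}).

(** If no insertion of v is possible, the successor map never leads from one link set into another, so
    there are at least |X'| + d separated sets, where d is the degree of v. At most d - 1 of their images under
    the successor map are non-edges, because E has more members than there are r-subsets of X' (the set X
    without v), and at most |X'| of them are used on the cycle. Some image is thus a free edge, and crossing applies. *)
Lemma ham_delete X E r v s : 2 < r -> r + 3 <= #|X| -> E \subset rsets X r -> v \in X ->
  'C(#|X|.-1, r) < #|E| -> 1 < #|star E v| -> ham_cycle (X :\ v) (avoiding E v) s -> hamiltonian X E.
Proof.
move=> r3 Xr EX vX cE dv sH.
have cX := cardsD1 v X; rewrite vX add1n in cX.
set X' := X :\ v in cX sH *; set E' := avoiding E v in sH *.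
have vX' : v \notin X' by rewrite !inE eqxx.
have sE : ham_cycle X' E s.
  case: sH => cs [us Xs Es]; split=> //; split=> // e /Es; by rewrite inE => /andP[].
have sv (e : {set V}) : v \in e -> inr e \notin s.
  by move=> ve; apply/negP; case: sH => _ [_ _ Es] /Es; rewrite inE ve andbF.
have -> : X = v |: X' by rewrite setD1K.
pose f := next_vertex s.
have fX x : x \in X' -> f x \in X' by exact: (next_vertex_in sE).
have f_inj : {in X' &, injective f} by exact: (next_vertex_inj sE).
pose L := link E v; have cL : #|L| = #|star E v| := card_link E v.
have LE B : B \in L -> [/\ v |: B \in E, v \notin B & B = (v |: B) :\ v].
  by case/linkP=> vB BE; rewrite setU1K.
have LX : L \subset rsets X' r.-1.
  by apply: (link_rsets vX); rewrite prednK //; clear -r3; lia.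
have neq B C : B \in L -> C \in L -> B != C -> v |: B != v |: C.
  by move=> /LE[_ _ eB] /LE[_ _ eC]; apply: contraNneq => eBC; rewrite eB eBC -eC.
have [/existsP[B /existsP[C /existsP[x]]]|nins] := boolP [exists B, exists C, exists x,
    [&& B \in L, C \in L, B != C, x \in B & f x \in C]].
  case/and5P=> BL CL BC xB fxC.
  have [BE _ _] := LE B BL; have [CE _ _] := LE C CL.
  have xX : x \in X' by have := subsetP LX B BL; rewrite inE => /andP[/subsetP-> //].
  apply: (insertion sE xX vX' (neq _ _ BL CL BC)) => //; rewrite ?sv ?in_setU1 ?eqxx ?xB ?orbT //.
  by rewrite -/(f x) fxC orbT.
have far B C x y : B \in L -> C \in L -> B != C -> x \in B -> y \in C -> f x != y.
  move=> BL CL BC xB yC; apply: contraNneq nins => e.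
  by apply/existsP; exists B; apply/existsP; exists C; apply/existsP; exists x; rewrite BL CL BC xB e yC.
have sepX T : T \in separated X' r L -> T \subset X' /\ #|T| = r.
  by rewrite inE => /andP[]; rewrite inE => /andP[-> /eqP].
pose W := [set f @: (T : {set V}) | T in separated X' r L].
have cW : #|X'| + #|L| <= #|W|.
  rewrite [#|W|]card_in_imset; last first.
    move=> S T SW TW eST; have [SX _] := sepX _ SW; have [TX _] := sepX _ TW.
    have im (A B : {set V}) : A \subset X' -> B \subset X' -> f @: A = f @: B -> A \subset B.
      move=> /subsetP AX /subsetP BX e; apply/subsetP=> x xA.
      have : f x \in f @: B by rewrite -e imset_f.
      by case/imsetP=> y yB /(f_inj _ _ (AX _ xA) (BX _ yB)) ->.
    by apply/eqP; rewrite eqEsubset (im _ _ SX TX eST) (im _ _ TX SX (esym eST)).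
  apply: (@separated_count V X' r L f) => //; first by clear -Xr cX; lia.
    by rewrite cL.
  exact: (next_vertex_closed sE).
pose U := [set next_edge s x | x in X'].
have : ~~ (W \subset (rsets X' r :\: E') :|: U).
  apply/negP=> /subset_leq_card.
  have [h1 _] := leq_card_setU (rsets X' r :\: E') U.
  have h2 : #|U| <= #|X'| by apply: leq_imset_card.
  have h3 := cardsD (rsets X' r) E'.
  have h4 := card_star_avoiding E v; rewrite -/E' in h4.
  have sub := avoiding_rsets v EX.
  move: h3 (card_rsets_le sub); rewrite (setIidPr sub) card_rsets.
  have -> : #|X'| = #|X|.-1 by rewrite cX.
  clear -h1 h2 h4 cW cE cL cX dv; rewrite -/X' -/E' => h3 h5 h6.
  have := leq_trans cW (leq_trans h6 (leq_trans h1 (leq_add (leqnn _) h2))).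
  rewrite h3 cL; move: cE; rewrite -h4; clear -h5; lia.
case/subsetPn=> _ /imsetP[T TW ->].
have [TX cT'] := sepX _ TW.
have cT : #|f @: T| = r.
  rewrite card_in_imset; first by [].
  by move=> x y /(subsetP TX) xX /(subsetP TX) yX; apply: f_inj.
have fTX : f @: T \subset X' by apply/subsetP=> _ /imsetP[x xT ->]; rewrite fX // (subsetP TX).
rewrite in_setU negb_or in_setD negb_and negbK => /andP[/orP[fTE|nX] fTU]; last first.
  have : f @: T \in rsets X' r by rewrite inE fTX cT eqxx.
  by rewrite (negPf nX).
have fTs : inr (f @: T) \notin s.
  by apply: contra fTU => /(edge_next_edge sE)[x xX ->]; apply: imset_f.
have vT : v \notin f @: T by apply: contra vX' => /(subsetP fTX).
have {}fTE : f @: T \in E by move: fTE; rewrite inE => /andP[].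
move: TW; rewrite inE => /andP[_ /exists_inP[B BL /exists_inP[C CL /exists_inP[x /setIP[xB xT] /exists_inP[y /setIP[yC yT] /andP[BC xy]]]]]].
have [BE _ _] := LE B BL; have [CE _ _] := LE C CL.
by apply: (crossing sE (subsetP TX _ xT) (subsetP TX _ yT) xy vX' (neq _ _ BL CL BC) _ _ fTs);
  rewrite ?sv // ?in_setU1 ?eqxx ?xB ?yC ?orbT // imset_f.
Qed.

(** Averaging: the numbers of edges avoiding x add up to |E| times |X| - r. *)
Lemma exists_deletion X E r : 2 < r -> r + 3 <= #|X| -> E \subset rsets X r ->
  'C(#|X|.-1, r) < #|E| -> exists2 v, v \in X & 'C(#|X|.-2, r).+1 < #|avoiding E v|.
Proof.
move=> r3 Xr EX cE; apply/exists_inP; apply: contraTT cE.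
rewrite negb_exists_in => /forall_inP small.
have : \sum_(x in X) #|avoiding E x| <= \sum_(x in X) ('C(#|X|.-2, r).+1).
  by apply: leq_sum => x /small; rewrite -leqNgt.
rewrite (sum_avoiding EX) sum_nat_const => le; apply/negP=> lt; move: le.
apply/negP; rewrite -ltnNge.
move: Xr lt; case: #|X| => [|[|n]] /=; [by clear -r3; lia..|] => Xr lt.
have e1 := mul_bin_left n.+1 r.
have [k def_r] : exists k, r = k.+1 by exists r.-1; clear -r3; lia.
have e2 : 'C(n.+1, r) = 'C(n, r) + 'C(n, r.-1) by rewrite def_r binS.
have e3 := mul_bin_down n.+1 r.
have e4 : r < 'C(n, r.-1).
  have : 'C(r.+1, r.-1) <= 'C(n, r.-1) by apply: leq_bin2l; clear -Xr; lia.
  apply: leq_trans; rewrite -(bin_sub (n := r.+1)); last by clear; lia.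
  have -> : r.+1 - r.-1 = 2 by clear -r3; lia.
  rewrite bin2 /=; clear -r3; case: r r3 => [|[|[|r]]] // _; nia.
clear e1; move: e3 => /= e3.
have : (n.+2 - r) * ('C(n.+1, r).+1) <= (n.+2 - r) * #|E| by rewrite leq_mul2l lt orbT.
have -> : n.+2 - r = (n.+1 - r).+1 by clear -Xr; lia.
have kr : n.+1 - r + r = n.+1 by clear -Xr; lia.
move: kr e3; set j := n.+1 - r; clear -e2 e4 => kr e3 h. 
move: kr e2 e3 e4 h; clearbody j; move: 'C(n.+1, r) 'C(n, r) 'C(n, r.-1) #|E| => C c b e.
clear => kr -> e3 br h; rewrite [e * _]mulnC; apply: leq_trans h.
have -> : j.+1 * (c + b).+1 = j * (c + b) + j + c + b + 1 by clear; nia.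
rewrite -e3; clear -kr br; nia.
Qed.

End Deletion.

(** * The case r = |X| - 2: extending a cycle of the link *)

Section Base.
Variable V : finType.
Implicit Types (x y v a b : V) (X : {set V}) (E : {set {set V}}) (e h g : {set V}).

Lemma subset_codim1 X g : g \subset X -> #|X| = #|g|.+1 -> exists2 u, u \in X & g = X :\ u.
Proof.
move=> gX cX.
have /card_gt0P[u uD] : 0 < #|X :\: g| by rewrite cardsD (setIidPr gX) cX subSnn.
have [uX ug] := setDP uD.
exists u => //; apply/eqP; rewrite eqEcard subsetD1 gX ug /=.
by have := cardsD1 u X; rewrite uX cX add1n => -[->].
Qed.

(** All edges of the cycle coming from the link contain v, and one more edge g is available because the
    cycle uses only |X| - 1 of them. If g contains v, insert v next to any vertex of g. Otherwise g misses a
    single vertex u, so it can take the place of the edge after the successor of u, and the edge released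
    that way leads to v. *)
Lemma ham_of_link X E v : v \in X -> 4 <= #|X| -> E \subset rsets X (#|X| - 2) -> #|X| <= #|E| ->
  hamiltonian (X :\ v) (link E v) -> hamiltonian X E.
Proof.
move=> vX X4 EX XE [s0 sH0].
have vX' : v \notin X :\ v by rewrite !inE eqxx.
have cX := cardsD1 v X; rewrite vX add1n in cX.
have lv (e : {set V}) : inr e \in s0 -> v \notin e /\ v |: e \in E.
  by case: sH0 => _ [_ _ Es] /Es /linkP.
have nl x : x \in X :\ v -> next_edge s0 x \in link E v by apply: next_edge_in sH0 _.
pose s := map (relabel (fun e : {set V} => v |: e)) s0.
have sH : ham_cycle (X :\ v) E s.
  apply: (ham_cycle_relabel sH0) => x.
  - by move=> xX; rewrite !in_setU1; have [-> ->] := next_incident sH0 xX; rewrite !orbT.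
  - by move/nl/linkP => [].
  - move=> y /nl/linkP[vx _] /nl/linkP[vy _] /(congr1 (fun A : {set V} => A :\ v)).
    by rewrite !setU1K.
have vs (e : {set V}) : inr e \in s -> v \in e.
  by case/mapP=> -[//|f] _ [->]; rewrite setU11.
have vc x : x \in X :\ v -> v \in next_edge s x.
  move=> xX; apply: vs; have [<- _] := nextP sH xX; rewrite mem_next.
  by case: sH => _ [_ -> _].
have [g gE gs] : exists2 g, g \in E & inr g \notin s.
  have /subsetPn[g gE gU] : ~~ (E \subset [set next_edge s x | x in X :\ v]).
    apply/negP=> /subset_leq_card; rewrite (card_used sH); clear -XE cX; lia.
  exists g => //; apply: contra gU => /(edge_next_edge sH)[x xX ->].
  exact: imset_f.
have gX : g \subset X /\ #|g| = #|X| - 2.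
  by have := subsetP EX _ gE; rewrite inE => /andP[-> /eqP ->].
rewrite -(setD1K vX).
have [vg|vg] := boolP (v \in g).
  have /card_gt0P[x /setD1P[xv xg]] : 0 < #|g :\ v|.
    have := cardsD1 v g; rewrite vg gX.2; clear -X4; lia.
  have xX : x \in X :\ v by rewrite in_setD1 xv (subsetP gX.1).
  have [i [t def_s]] := rot_vertex sH xX.
  have [cs sp] := ham_cycle_rot i sH; rewrite def_s in cs sp.
  have gt : inr g \notin inl x :: inr (next_edge s x) :: t by rewrite -def_s mem_rot.
  exists (inl x :: inr g :: inl v :: inr (next_edge s x) :: t); split.
    by move: cs; rewrite /= xg vg vc // => /andP[].
  apply: (@spans_perm _ _ _ (inl v :: inr g :: inl x :: inr (next_edge s x) :: t)).
    by apply/seq.permP=> P /=; clear; lia.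
  apply: (spans_vertex vX'); apply: (spans_edge gE gt) => //.
have [u uX def_g] : exists2 u, u \in X :\ v & g = (X :\ v) :\ u.
  have sg : g \subset X :\ v by rewrite subsetD1 gX.1.
  have /card_gt0P[u uD] : 0 < #|(X :\ v) :\: g|.
    rewrite cardsD (setIidPr sg) gX.2; clear -cX X4; lia.
  have [uX ug] := setDP uD.
  exists u => //; apply/eqP; rewrite eqEcard subsetD1 sg ug gX.2 /=.
  have := cardsD1 u (X :\ v); rewrite uX; clear -cX; lia.
have nX := next_vertex_in sH.
have c1 : 0 < 1 < #|X :\ v| by clear -X4 cX; lia.
set x := next_vertex s u.
have xg : x \in g.
  rewrite def_g in_setD1 nX // andbT.
  by apply: (no_short_cycle (k := 1) sH) => //; clear -X4 cX; lia.
have yg : next_vertex s x \in g.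
  rewrite def_g in_setD1 !nX // andbT.
  by apply: (no_short_cycle (k := 2) sH) => //; clear -X4 cX; lia.
have xX : x \in X :\ v by rewrite nX.
have [i [t def_s]] := rot_vertex sH xX.
have hd := next_vertex_head sH xX def_s.
have [cs sp] := ham_cycle_rot i sH; rewrite def_s in cs sp.
have gt : inr g \notin inl x :: inr (next_edge s x) :: t by rewrite -def_s mem_rot.
exists (inl v :: inr (next_edge s x) :: inl x :: inr g :: t); split; last first.
  apply: (@spans_perm _ _ _ (inl v :: inr g :: inl x :: inr (next_edge s x) :: t)).
    by apply/seq.permP=> P /=; clear; lia.
  apply: (spans_vertex vX'); apply: (spans_edge gE gt) => //.
have [xc _] := next_incident sH xX.
move: cs; rewrite /= vc // xc xg /= => pt.
have := path_start pt (_ : incident (inr g) (head (inl x) t)); rewrite hd => /(_ yg).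
rewrite !rcons_path => /andP[-> lt] /=.
have : last (inr g) t \in rot i s.
  rewrite def_s; case: (t) hd => [[ex]|b u' _] /=; last by rewrite 2!(in_cons, mem_last) /= ; apply/or3P; apply: Or33; exact: mem_last.
  by have := no_short_cycle (k := 1) sH xX; rewrite /= -ex eqxx => /(_ c1).
by case: last lt => [//|e] _; rewrite mem_rot => /vs.
Qed.

(** The virtual edge h, lying between b and a on the cycle, is replaced by the detour g, v, f. *)
Lemma ham_close X E b h t a v f g : ham_cycle X (h |: E) (inl b :: inr h :: t) ->
  head (inl b) t = inl a -> v \notin X -> f \in E -> g \in E -> f != g ->
  inr f \notin inl b :: inr h :: t -> inr g \notin inl b :: inr h :: t ->
  a \in f -> v \in f -> b \in g -> v \in g -> hamiltonian (v |: X) E.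
Proof.
move=> [cs sp] hd vX fE gE fg fs gs af vf bg vg.
have sp1 : spans X (h |: E) (inr h :: inl b :: t).
  by apply: spans_perm sp; apply/seq.permP=> P /=; clear; lia.
have sp2 : spans X E (inl b :: t).
  have [u2 X2 E2] := spans_behead sp1; split=> // e et.
  have /setU1P[eh|//] := E2 e et.
  by have [/andP[hn _] _ _] := sp1; rewrite -eh et in hn.
have nin e : inr e \notin inl b :: inr h :: t -> inr e \notin inl b :: t.
  by rewrite !in_cons !negb_or => /and3P[-> _ ->].
exists (inl v :: inr f :: t ++ [:: inl b; inr g]); split; last first.
  apply: (@spans_perm _ _ _ (inl v :: inr f :: inr g :: inl b :: t)).
    by apply/seq.permP=> P; rewrite /= count_cat /=; clear; lia.
  apply: (spans_vertex vX); apply: (spans_edge fE).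
    by rewrite in_cons negb_or (inr_neq fg) (nin _ fs).
  exact: (spans_edge gE (nin _ gs) sp2).
move: cs => /= /andP[_ pt].
have := path_start pt (_ : incident (inr f) (head (inl b) t)); rewrite hd => /(_ af).
rewrite -cats1 !cat_path /= vf => /and3P[pf lf _].
by rewrite rcons_path cat_path pf /= lf bg last_cat /= vg.
Qed.

(** Two edges of the cycle are released for the detour at v by letting g1 and g2, which avoid v, take their
    places; the remaining edges of the link get v back. *)
Lemma ham_close_release X E b h t v x1 x2 g1 g2 (s := inl b :: inr h :: t) :
  v \notin X -> ham_cycle X (h |: link E v) s -> x1 \in X -> x2 \in X ->
  x1 != b -> x2 != b -> x1 != x2 ->
  v \notin h -> h != g1 -> h != g2 -> v \notin g1 -> v \notin g2 -> g1 != g2 -> g1 \in E -> g2 \in E ->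
  next_vertex s b \in next_edge s x1 -> b \in next_edge s x2 ->
  x1 \in g1 -> next_vertex s x1 \in g1 -> x2 \in g2 -> next_vertex s x2 \in g2 ->
  hamiltonian (v |: X) E.
Proof.
move=> vX sH x1X x2X x1b x2b x12 vh hg1 hg2 vg1 vg2 g12 g1E g2E a1 b2 x1g y1g x2g y2g.
have bX : b \in X by case: sH => _ [_ <- _]; rewrite in_cons eqxx.
have hb : next_edge s b = h.
  by have [+ _] := nextP sH bX; rewrite -(next_head sH (i := 0) (rot0 _)) => -[].
have hd : head (inl b) t = inl (next_vertex s b).
  by apply: (next_vertex_head (i := 0) sH bX); rewrite rot0 hb.
have neq x y : x \in X -> y \in X -> x != y -> next_edge s x != next_edge s y.
  by move=> xX yX; apply: contraNneq => /(next_edge_inj sH xX yX) ->.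
have lnk x : x \in X -> x != b -> v \notin next_edge s x /\ v |: next_edge s x \in E.
  move=> xX xb; apply/linkP; have := next_edge_in sH xX.
  by rewrite in_setU1 -{1}hb (negPf (neq _ _ xX bX xb)).
set e1 := next_edge s x1; set e2 := next_edge s x2.
have e1h : e1 != h by rewrite -hb neq.
have e2h : e2 != h by rewrite -hb neq.
have e12 : e1 != e2 by rewrite neq.
pose r e := if e == e1 then g1 else if e == e2 then g2 else if e == h then h else v |: e.
have rh : r h = h by rewrite /r ![h == _]eq_sym (negPf e1h) (negPf e2h) eqxx.
have rnh x : x \in X -> x != b -> r (next_edge s x) != h.
  move=> xX xb; have xh : next_edge s x != h by rewrite -hb neq.
  rewrite /r (negPf xh); case: ifP => _; first by rewrite eq_sym.
  case: ifP => _; first by rewrite eq_sym.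
  by apply: contraNneq vh => <-; rewrite setU11.
have sH2 : ham_cycle X (h |: E) (map (relabel r) s).
  apply: (ham_cycle_relabel sH) => x.
  - move=> xX; rewrite /r; have [n1 n2] := next_incident sH xX.
    case: eqP => [/(next_edge_inj sH xX x1X) ->//|_].
    case: eqP => [/(next_edge_inj sH xX x2X) ->//|_].
    by case: eqP => [<-//|_]; rewrite !in_setU1 n1 n2 !orbT.
  - move=> xX; rewrite /r.
    case: eqP => _; first by rewrite in_setU1 g1E orbT.
    case: eqP => _; first by rewrite in_setU1 g2E orbT.
    case: eqP => [_|xh]; first by rewrite setU11.
    by rewrite in_setU1 (lnk _ xX _).2 ?orbT //; apply/eqP=> xb; case: xh; rewrite xb.
  - move=> y xX yX.
    have [xb|xb] := eqVneq x b; have [yb|yb] := eqVneq y b; first by rewrite xb yb.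
    + by rewrite xb hb rh => /esym/eqP; rewrite (negPf (rnh _ yX yb)).
    + by rewrite yb hb rh => /eqP; rewrite (negPf (rnh _ xX xb)).
    have [vx _] := lnk x xX xb; have [vy _] := lnk y yX yb.
    have xh : next_edge s x != h by rewrite -hb neq.
    have yh : next_edge s y != h by rewrite -hb neq.
    rewrite /r (negPf xh) (negPf yh).
    have vn g z : v \notin g -> g = v |: z -> False by move=> vg eg; rewrite eg setU11 in vg.
    have [->|_] := eqVneq (next_edge s x) e1; have [->|_] := eqVneq (next_edge s y) e1 => //.
    + have [_|_] := eqVneq (next_edge s y) e2 => e; last by case: (vn _ _ vg1 e).
      by rewrite e eqxx in g12.
    + have [_|_] := eqVneq (next_edge s x) e2 => e; last by case: (vn _ _ vg1 (esym e)).
      by rewrite e eqxx in g12.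
    have [->|_] := eqVneq (next_edge s x) e2; have [->|_] := eqVneq (next_edge s y) e2 => // e.
    + by case: (vn _ _ vg2 e).
    + by case: (vn _ _ vg2 (esym e)).
    by have := congr1 (fun A : {set V} => A :\ v) e; rewrite !setU1K.
rewrite /= rh in sH2.
have notr x : x \in X -> x != b -> (next_edge s x == e1) || (next_edge s x == e2) ->
   inr (v |: next_edge s x) \notin inl b :: inr h :: map (relabel r) t.
  move=> xX xb ex; have [vx _] := lnk x xX xb.
  have vn g : v \notin g -> v |: next_edge s x != g by apply: contraNneq => <-; rewrite setU11.
  rewrite 2!in_cons 2!negb_or (inr_neq (vn _ vh)) /=.
  apply/mapP=> -[[//|e] et [E']]; move: E'; rewrite /r.
  case: eqP => [_ /eqP|ne1]; first by rewrite (negPf (vn _ vg1)).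
  case: eqP => [_ /eqP|ne2]; first by rewrite (negPf (vn _ vg2)).
  case: eqP => [_ /eqP|neh]; first by rewrite (negPf (vn _ vh)).
  have es : inr e \in s by rewrite !in_cons et !orbT.
  have [y yX def_e] := edge_next_edge sH es.
  have [vy _] : v \notin e /\ v |: e \in E by rewrite def_e; apply: lnk => //; apply/eqP=> yb; case: neh; rewrite def_e yb.
  move/(congr1 (fun A : {set V} => A :\ v)); rewrite !setU1K // => exe.
  by move: ex; rewrite exe => /orP[]/eqP.
apply: (ham_close (f := v |: e1) (g := v |: e2) sH2 (a := next_vertex s b)) => //.
- by case: (t) hd => [|z u] //= ->.
- by have [] := lnk _ x1X x1b.
- by have [] := lnk _ x2X x2b.
- have [n1 _] := lnk _ x1X x1b; have [n2 _] := lnk _ x2X x2b.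
  by apply: contraNneq e12 => /(congr1 (fun A : {set V} => A :\ v)); rewrite !setU1K // => ->.
- by apply: notr; rewrite ?eqxx.
- by apply: notr; rewrite ?eqxx ?orbT.
- by rewrite in_setU1 a1 orbT.
- by rewrite setU11.
- by rewrite in_setU1 b2 orbT.
- by rewrite setU11.
Qed.

(** With r = |X| - 2, if w and x both had degree two then E would have at most 2 + 2 + 1 members, the
    last one being the complement of the pair. So an edge avoiding a vertex of degree two can be dropped. *)
Lemma exists_shrink X E : 5 <= #|X| -> E \subset rsets X (#|X| - 2) -> #|X| < #|E| ->
  (forall x, x \in X -> 1 < #|star E x|) ->
  exists2 e, e \in E & forall x, x \in X -> 1 < #|star (E :\ e) x|.
Proof.
move=> X5 EX XE dE.
have dD e x : 1 < #|star E x| -> x \notin e \/ 2 < #|star E x| -> 1 < #|star (E :\ e) x|.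
  have -> : star (E :\ e) x = star E x :\ e by apply/setP=> g; rewrite !inE andbA.
  move=> d1 [xe|d2]; last first.
    by move: d2; rewrite (cardsD1 e (star E x)); case: (e \in star E x) => // /ltnW.
  suff -> : star E x :\ e = star E x by [].
  apply/setP=> g; rewrite !inE; case: eqVneq => // ->.
  by rewrite (negPf xe) andbF.
have [/forall_inP d3|] := boolP [forall x in X, 2 < #|star E x|].
  have /card_gt0P[e eE] : 0 < #|E| by clear -XE; lia.
  by exists e => // x xX; apply: dD; [exact: dE|right; exact: d3].
rewrite negb_forall_in => /exists_inP[w wX]; rewrite -leqNgt => dw.
have /card_gt0P[e] : 0 < #|avoiding E w|.
  have := card_star_avoiding E w; clear -dw XE X5; lia.
rewrite inE => /andP[eE we]; exists e => // x xX; apply: dD; first exact: dE.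
have [xe|xe] := boolP (x \in e); [right|by left].
have xw : x != w by apply: contraTneq xe => ->.
have h1 := card_star_avoiding E w.
have h2 := card_star_avoiding (avoiding E w) x.
have h3 := card_avoiding2 EX wX xX (_ : w != x).
rewrite eq_sym in h3; have {}h3 := h3 xw.
have : #|star (avoiding E w) x| <= #|star E x|.
  by apply: star_sub; apply/subsetP=> g; rewrite inE => /andP[].
clear -h1 h2 h3 dw XE X5; lia.
Qed.

(** The induction hypothesis of the base case, in which the uniformity is always the number of vertices
    minus two; it is applied to links. *)
Definition ham_below X := forall (X' : {set V}) (E' : {set {set V}}), #|X'| = #|X|.-1 ->
  E' \subset rsets X' (#|X'| - 2) -> #|X'| <= #|E'| -> (forall x, x \in X' -> 1 < #|star E' x|) ->
  hamiltonian X' E'.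

Lemma ham_by_link X E v : 6 <= #|X| -> E \subset rsets X (#|X| - 2) -> #|X| <= #|E| -> ham_below X ->
  v \in X -> #|X|.-1 <= #|star E v| -> (forall w, w \in X -> w != v -> 1 < #|star (star E v) w|) ->
  hamiltonian X E.
Proof.
move=> X6 EX XE IH vX dv codeg.
have cX : #|X :\ v| = #|X|.-1 by rewrite (cardsD1 v X) vX.
apply: (ham_of_link vX _ EX XE); first by clear -X6; lia.
apply: IH; rewrite ?cX ?card_link //.
  apply: (link_rsets vX); have -> : (#|X|.-1 - 2).+1 = #|X| - 2 by clear -X6; lia.
  exact: EX.
move=> w /setD1P[wv wX]; apply: leq_trans (card_star_link E wv); exact: codeg.
Qed.

(** Read E as the graph of the complements of its edges: it is 2-regular. Let u1 and u2 be the neighbours of v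
    in that graph, so that g1 and g2 are the two edges avoiding v. The link of v is one edge short of the
    induction hypothesis, so a virtual edge h avoiding u1 and a non-neighbour y of u1 is added. The cycle
    obtained must use h; its other edges extend through v, and it has to be closed at v instead of h.
    Write P 0, P 1, ... for consecutive vertices such that h lies between P 3 and P 4. The edge after P 4
    is released by one of g1, g2 and the edge after P 2 by the other; at least one of the two choices
    works unless u1 and u2 occupy P 5 and P 4, or P 2 and P 3. In these cases one of the two released
    edges is taken one or two places further away from h. *)
Lemma ham_regular X E : 6 <= #|X| -> E \subset rsets X (#|X| - 2) -> #|E| = #|X| -> ham_below X ->
  (forall x, x \in X -> #|avoiding E x| = 2) -> hamiltonian X E.
Proof.
move=> X6 EX XE IH reg.
have /card_gt0P[v vX] : 0 < #|X| by clear -X6; lia.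
have /eqP/cards2P[g1 [g2 [g12 def_g]]] := reg v vX.
set X' := X :\ v.
have vX' : v \notin X' by rewrite !inE eqxx.
have cX : #|X| = #|X'|.+1 by rewrite (cardsD1 v X) vX.
have gP g : g \in [set g1; g2] -> [/\ g \in E, v \notin g & exists2 u, u \in X' & g = X' :\ u].
  rewrite -def_g => gv; have [gX cg] := mem_rsets (avoiding_rsets v EX) gv.
  move: gv; rewrite inE => /andP[gE vg]; split=> //; apply: subset_codim1 => //.
  by rewrite cg -/X'; clear -X6 cX; lia.
have [g1E vg1 [u1 u1X def_g1]] := gP g1 (set21 _ _).
have [g2E vg2 [u2 u2X def_g2]] := gP g2 (set22 _ _).
have u12 : u1 != u2 by apply: contraNneq g12 => eu; rewrite def_g1 def_g2 eu.
have [u1v u1X0] := setD1P u1X; have [u2v u2X0] := setD1P u2X.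
have u1g1 : g1 \in avoiding E u1 by rewrite inE g1E def_g1 !inE eqxx.
have [g3 g31 def_a1] : exists2 g3, g3 \in avoiding E u1 & avoiding E u1 = [set g1; g3].
  have := cardsD1 g1 (avoiding E u1); rewrite u1g1 reg // => -[/esym/eqP/cards1P[g3 e3]].
  by exists g3; [have := set11 g3; rewrite -e3 => /setD1P[]|rewrite -e3 setD1K].
(* The vertex y is chosen in the second edge g3 avoiding u1, so that h extended by v is neither g1 nor g3. *)
have [y yv yg3] : exists2 y, y != v & y \in g3.
  have [g3E _] := setIdP g31.
  have /card_gt0P[y /setD1P[yv yg]] : 0 < #|g3 :\ v|.
    have [_ c3] := mem_rsets EX g3E; have := cardsD1 v g3; rewrite c3; clear -X6; case: (v \in g3); lia.
  by exists y.
have yu1 : y != u1 by apply: contraTneq yg3 => ->; have [_ ] := setIdP g31.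
have yX : y \in X' by rewrite in_setD1 yv; have [g3E _] := setIdP g31; have [/subsetP-> ] := mem_rsets EX g3E.
pose h := X' :\ u1 :\ y.
have vh : v \notin h by rewrite !inE eqxx !andbF.
have ch : #|h| = #|X'| - 2.
  have := cardsD1 u1 X'; have := cardsD1 y (X' :\ u1); rewrite u1X in_setD1 yu1 yX /=.
  by rewrite /h => -> ->; rewrite addnA addKn.
have hE : h \notin link E v.
  apply/linkP=> -[_ hE].
  have : v |: h \in avoiding E u1 by rewrite inE hE !inE (negPf u1v) eqxx andbF.
  rewrite def_a1 !inE => /orP[]/eqP e.
    by rewrite -e setU11 in vg1.
  by rewrite -e !inE (negPf yv) eqxx in yg3.
have [s0 sH0] : hamiltonian X' (h |: link E v).
  apply: IH; first by rewrite cX.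
  - rewrite subUset sub1set inE ch eqxx andbT.
    rewrite (subset_trans (subsetDl _ _) (subsetDl _ _)) /=.
    apply: (link_rsets vX); have -> : (#|X'| - 2).+1 = #|X| - 2 by clear -X6 cX; lia.
    exact: EX.
  - rewrite cardsU1 hE card_link; have := card_star_avoiding E v; rewrite reg // XE.
    clear -cX X6; lia.
  move=> x /setD1P[xv xX]; apply: leq_trans (star_sub x (subsetUr _ _)).
  apply: leq_trans (card_star_link E xv).
  have h1 := card_star_avoiding E v; have h2 := card_star_avoiding (star E v) x.
  have : #|avoiding (star E v) x| <= #|avoiding E x|.
    by apply: subset_leq_card; apply/subsetP=> e; rewrite !inE => /andP[/andP[-> _]].
  rewrite (reg x xX) => h3; rewrite (reg v vX) XE in h1.
  clear -X6 h1 h2 h3; lia.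
(* The link has |X| - 2 members, so the cycle on |X| - 1 vertices must use h. *)
have [b bX hb] : exists2 b, b \in X' & h = next_edge s0 b.
  apply: (edge_next_edge sH0).
  have : [set next_edge s0 x | x in X'] = h |: link E v.
    apply/eqP; rewrite eqEcard (card_used sH0); apply/andP; split.
      by apply/subsetP=> _ /imsetP[x xX ->]; apply: next_edge_in sH0 _ _.
    rewrite cardsU1 hE card_link; have := card_star_avoiding E v; rewrite reg // XE.
    clear -cX X6; lia.
  move/setP/(_ h); rewrite setU11 => /imsetP[x xX ->].
  by have [<- _] := nextP sH0 xX; rewrite mem_next; case: sH0 => _ [_ -> _].
have [i [t def_s]] := rot_vertex sH0 bX; rewrite -hb in def_s.
have := ham_cycle_rot i sH0; rewrite def_s => {s0 sH0 hb def_s i}.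
set s := _ :: _ => sH.
have hb : next_edge s b = h.
  by have [+ _] := nextP sH bX; rewrite -(next_head sH (i := 0) (rot0 _)) => -[].
have X'5 : 5 <= #|X'| by clear -cX X6; lia.
have [b1 b1X e1] := next_vertex_pre sH bX.
have [b2 b2X e2] := next_vertex_pre sH b1X.
have [p pX e3] := next_vertex_pre sH b2X.
set f := next_vertex s in e1 e2 e3 *.
pose P k := iter k f p.
have PX k : P k \in X' by elim: k => //= k; apply: next_vertex_in sH _.
have PS k : f (P k) = P k.+1 by [].
have P3 : P 3 = b by rewrite /P /= e3 e2 e1.
have ne k j : k < j <= k + 4 -> P j != P k.
  move=> kj; have -> : P j = iter (j - k) f (P k) by rewrite /P -iterD subnK //; clear -kj; lia.
  by apply: (no_short_cycle sH) => //; clear -kj X'5; lia.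
have [b_in a_in] := next_incident sH bX; rewrite hb -/f -P3 PS in b_in a_in.
have P3u1 : P 3 != u1 by apply: contraTneq b_in => ->; rewrite !inE eqxx !andbF.
have P4u1 : P 4 != u1 by apply: contraTneq a_in => ->; rewrite !inE eqxx !andbF.
have inP k u g : g = X' :\ u -> P k != u -> P k \in g by move=> -> ku; rewrite in_setD1 ku PX.
have nb k : k != 3 -> k < 8 -> P k != b.
  rewrite -P3 => k3 k8; have [lt|gt] := ltnP k 3.
    by rewrite eq_sym; apply: ne; clear -lt; lia.
  by apply: ne; clear -gt k3 k8; lia.
have inc0 := next_incident sH.
have inc k : P k \in next_edge s (P k) /\ P k.+1 \in next_edge s (P k) by apply: inc0.
(* Of the two edges avoiding u2 one is g2, so at most one extends a member of the link. *)
have twice x x' : x \in X' -> x' \in X' -> x != b -> x' != b -> x != x' ->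
    (u2 \in next_edge s x) || (u2 \in next_edge s x').
  move=> xX x'X xb x'b xx'; apply/negPn; rewrite negb_or; apply/negP=> /andP[n1 n2].
  have neq z w : z \in X' -> w \in X' -> z != w -> next_edge s z != next_edge s w.
    by move=> zX wX; apply: contraNneq => /(next_edge_inj sH zX wX) ->.
  have lnk z : z \in X' -> z != b -> v \notin next_edge s z /\ v |: next_edge s z \in E.
    move=> zX zb; apply/linkP; have := next_edge_in sH zX.
    by rewrite in_setU1 -{1}hb (negPf (neq _ _ zX bX zb)).
  have [v1 E1] := lnk _ xX xb; have [v2 E2] := lnk _ x'X x'b.
  have : [set g2; v |: next_edge s x; v |: next_edge s x'] \subset avoiding E u2.
    by rewrite !subUset !sub1set !inE g2E E1 E2 (negPf u2v) n1 n2 def_g2 !inE eqxx.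
  move/subset_leq_card; rewrite reg // setUC cardsU1 cards2 !inE negb_or.
  have ng z : v |: z != g2 by apply: contraNneq vg2 => <-; rewrite setU11.
  rewrite ng [g2 == _]eq_sym ng /= eq_sym.
  have -> // : v |: next_edge s x != v |: next_edge s x'.
  apply: contraNneq (neq _ _ xX x'X xx') => /(congr1 (fun A : {set V} => A :\ v)).
  by rewrite !setU1K // => ->.
have hg g u : g = X' :\ u -> u \in X' -> h != g.
  move=> -> uX; apply: contraTneq isT => eh; move: ch; rewrite eh.
  have := cardsD1 u X'; rewrite uX; clear -X'5; lia.
have hg1 := hg _ _ def_g1 u1X; have hg2 := hg _ _ def_g2 u2X.
have g21 : g2 != g1 by rewrite eq_sym.
rewrite -(setD1K vX).
have release12 k j : k != 3 -> j != 3 -> k < 8 -> j < 8 -> P k != P j ->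
   P 4 \in next_edge s (P k) -> P 3 \in next_edge s (P j) ->
   P k != u1 -> P k.+1 != u1 -> P j != u2 -> P j.+1 != u2 -> hamiltonian (v |: X') E.
  move=> k3 j3 k8 j8 kj a4 b3 k1 k2 j1 j2.
  apply: (ham_close_release (x1 := P k) (x2 := P j) (g1 := g1) (g2 := g2) vX' sH) => //; rewrite ?nb //.
  + by move: a4; rewrite -[P 4]/(f (P 3)) P3.
  + by rewrite P3 in b3.
  + exact: inP def_g1 _.
  + by rewrite -/f PS; exact: inP def_g1 _.
  + exact: inP def_g2 _.
  + by rewrite -/f PS; exact: inP def_g2 _.
have release21 k j : k != 3 -> j != 3 -> k < 8 -> j < 8 -> P k != P j ->
   P 4 \in next_edge s (P k) -> P 3 \in next_edge s (P j) ->
   P k != u2 -> P k.+1 != u2 -> P j != u1 -> P j.+1 != u1 -> hamiltonian (v |: X') E.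
  move=> k3 j3 k8 j8 kj a4 b3 k1 k2 j1 j2.
  apply: (ham_close_release (x1 := P k) (x2 := P j) (g1 := g2) (g2 := g1) vX' sH) => //; rewrite ?nb //.
  + by move: a4; rewrite -[P 4]/(f (P 3)) P3.
  + by rewrite P3 in b3.
  + exact: inP def_g2 _.
  + by rewrite -/f PS; exact: inP def_g2 _.
  + exact: inP def_g1 _.
  + by rewrite -/f PS; exact: inP def_g1 _.
have a4 := (inc 4).1; have b3 := (inc 2).2.
have [u1_5|n15] := eqVneq (P 5) u1.
  have [u2_4|n24] := eqVneq (P 4) u2.
    have [k [k56 a_k]] : exists k, (k == 5) || (k == 6) /\ P 4 \in next_edge s (P k).
      have := twice (P 5) (P 6); rewrite !PX !nb // -u2_4 [P 5 == _]eq_sym ne //.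
      by move=> /(_ isT isT isT isT isT)/orP[]; [exists 5|exists 6].
    case/orP: k56 a_k => /eqP-> a_k; apply: (@release21 _ 2) a_k b3 _ _ _ _ => //;
      rewrite -?u2_4 -?u1_5; ((by rewrite ne) || (by rewrite eq_sym ne)).
  apply: (@release21 4 2) => //; first by rewrite ne.
  - by rewrite u1_5 eq_sym in u12 *.
  - by rewrite -u1_5 eq_sym ne.
have [u2_23|] := boolP ((P 2 == u2) || (P 3 == u2)); last first.
  by rewrite negb_or => /andP[n2 n3]; apply: (@release12 4 2); rewrite ?ne.
have n45 : (P 4 != u2) && (P 5 != u2).
  by case/orP: u2_23 => /eqP<-; rewrite !ne.
have [n4 n5] := andP n45.
have [u1_2|n12] := eqVneq (P 2) u1; last by apply: (@release21 4 2); rewrite ?ne.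
have {u2_23} u2_3 : P 3 = u2.
  by case/orP: u2_23 => /eqP // e; rewrite -e u1_2 eqxx in u12.
have [k [k01 b_k]] : exists k, (k == 0) || (k == 1) /\ P 3 \in next_edge s (P k).
  have := twice (P 0) (P 1); rewrite !PX !nb // -u2_3 [P 0 == _]eq_sym ne //.
  by move=> /(_ isT isT isT isT isT)/orP[]; [exists 0|exists 1].
case/orP: k01 b_k => /eqP-> b_k; apply: (@release12 4 _) a4 b_k _ _ _ _ => //;
  rewrite -?u2_3 -?u1_2; ((by rewrite ne) || (by rewrite eq_sym ne)).
Qed.

(** After reducing to |E| = |X| the degrees in the complement graph add up to 2|X|. If it is not 2-regular, some
    vertex v is missed by at most one edge. Its link satisfies the hypotheses unless some w has degree two;
    then a common vertex z of the two edges at w is missed by at most one edge, and its link does. *)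
Lemma base_step X E : 6 <= #|X| -> E \subset rsets X (#|X| - 2) -> #|X| <= #|E| -> ham_below X ->
  (forall x, x \in X -> 1 < #|star E x|) -> hamiltonian X E.
Proof.
move=> X6 EX XE IH dE.
have [k] := ubnP #|E|; elim: k => // k IHk in E EX XE dE *; rewrite ltnS => Ek.
have [XE'|] := ltnP #|X| #|E|.
  have [|e eE dD] := exists_shrink _ EX XE' dE; first by clear -X6; lia.
  have cE := cardsD1 e E; rewrite eE in cE.
  apply: (@hamiltonianS _ _ (E :\ e)); first exact: subD1set.
  apply: IHk => //; [exact: subset_trans (subD1set _ _) EX|clear -cE XE'; lia|clear -cE Ek; lia].
move=> EX'; have {IHk Ek} cE : #|E| = #|X| by apply/eqP; rewrite eqn_leq EX'.
have sum2 := sum_avoiding EX; rewrite cE subKn in sum2; last by clear -X6; lia.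
have [/forall_inP reg|] := boolP [forall x in X, #|avoiding E x| == 2].
  by apply: ham_regular => // x xX; apply/eqP; apply: reg.
move=> nreg.
have [v vX av] : exists2 v, v \in X & #|avoiding E v| <= 1.
  apply/exists_inP; apply: contraR nreg; rewrite negb_exists_in => /forall_inP ge2.
  have : \sum_(x in X) (#|avoiding E x| - 2) = 0.
    rewrite sumnB; last by move=> x /ge2; rewrite -ltnNge.
    by rewrite sum2 sum_nat_const subnn.
  move/eqP; rewrite sum_nat_eq0 => /forall_inP z; apply/forall_inP=> x xX.
  have := ge2 x xX; have := z x xX; clear; lia.
have [/exists_inP[w wX dw]|] := boolP [exists w in X, #|star E w| <= 2]; last first.
  rewrite negb_exists_in => /forall_inP d3.
  apply: (@ham_by_link _ _ v) => //.
    have := card_star_avoiding E v; clear -av cE; lia.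
  move=> w wX wv.
  have : #|star E w| <= #|star (star E v) w :|: avoiding E v|.
    apply: subset_leq_card; apply/subsetP=> e; rewrite !inE => /andP[-> ->].
    by case: (v \in e).
  have [+ _] := leq_card_setU (star (star E v) w) (avoiding E v).
  have := d3 w wX; clear -av; lia.
have dw2 : #|star E w| = 2 by apply/eqP; rewrite eqn_leq dw dE.
have /eqP/cards2P[g1 [g2 [g12 def_g]]] := dw2.
have gP g : g \in [set g1; g2] -> [/\ g \in E, w \in g, g \subset X & #|g| = #|X| - 2].
  by rewrite -def_g inE => /andP[gE wg]; have [] := mem_rsets EX gE.
have [g1E wg1 g1X c1] := gP g1 (set21 _ _).
have [g2E wg2 g2X c2] := gP g2 (set22 _ _).
have [z [zw zg1 zg2]] : exists z, [/\ z != w, z \in g1 & z \in g2].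
  have /card_gt0P[z /setD1P[zw /setIP[? ?]]] : 0 < #|(g1 :&: g2) :\ w|; last by exists z.
  have h1 := cardsU g1 g2; have h2 := cardsD1 w (g1 :&: g2).
  have : #|g1 :|: g2| <= #|X| by apply: subset_leq_card; rewrite subUset g1X.
  rewrite in_setI wg1 wg2 in h2; have : #|g1 :&: g2| <= #|g1| by apply: subset_leq_card; apply: subsetIl.
  clear -h1 h2 c1 c2 X6; rewrite c1 c2 in h1 *; lia.
have zX := subsetP g1X _ zg1.
have wz : w != z by rewrite eq_sym.
have stw : star E w \subset star (star E z) w.
  apply/subsetP=> e ew; have := ew; rewrite def_g !inE.
  by case/orP=> /eqP->; rewrite ?g1E ?g2E ?zg1 ?zg2 ?wg1 ?wg2.
have aw := card_star_avoiding E w.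
have azw := card_avoiding2 EX wX zX wz.
apply: (@ham_by_link _ _ z) => //.
  have : avoiding E z \subset avoiding (avoiding E w) z.
    apply/subsetP=> e; rewrite !inE => /andP[eE ze]; rewrite eE ze andbT /=.
    apply: contra ze => we.
    by have : e \in star E w by [rewrite inE eE]; rewrite def_g => /set2P[]->.
  move/subset_leq_card => h; have := card_star_avoiding E z; clear -h azw cE; lia.
move=> x xX xz; have [->|xw] := eqVneq x w.
  by rewrite -dw2 subset_leq_card.
have wx : w != x by rewrite eq_sym.
have axw := card_avoiding2 EX wX xX wx.
have : #|avoiding E w| <= #|star (star E z) x :|: (avoiding (avoiding E w) z :|: avoiding (avoiding E w) x)|.
  apply: subset_leq_card; apply/subsetP=> e; rewrite !inE => /andP[-> ->].
  by case: (z \in e); case: (x \in e).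
have [+ _] := leq_card_setU (star (star E z) x) (avoiding (avoiding E w) z :|: avoiding (avoiding E w) x).
have [+ _] := leq_card_setU (avoiding (avoiding E w) z) (avoiding (avoiding E w) x).
clear -aw azw axw dw2 cE X6; lia.
Qed.

End Base.

(** * Five vertices *)

Fixpoint sublists (T : Type) (s : seq T) : seq (seq T) :=
  if s is x :: s' then let r := sublists s' in r ++ map (cons x) r else [:: [::]].

Lemma filter_sublists (T : eqType) (P : pred T) s : filter P s \in sublists s.
Proof.
elim: s => //= x s IH; rewrite mem_cat; case: (P x); last by rewrite IH.
by rewrite map_f ?orbT.
Qed.

Lemma sublists_subset (T : eqType) (s t : seq T) : t \in sublists s -> {subset t <= s}.
Proof.
elim: s t => [|x s IH] t /=; first by rewrite inE => /eqP->.
rewrite mem_cat => /orP[/IH ts y /ts|/mapP[u /IH us ->] y]; first by rewrite inE => ->; rewrite orbT.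
by rewrite !inE => /orP[->//|/us ->]; rewrite orbT.
Qed.

(** A search with early exit: the boolean connectives evaluate both arguments under call by value. *)
Fixpoint hasl (T : Type) (p : pred T) (s : seq T) : bool :=
  if s is x :: s' then if p x then true else hasl p s' else false.

Lemma haslE (T : Type) (p : pred T) s : hasl p s = has p s.
Proof. by elim: s => //= x s ->; case: (p x). Qed.

Fixpoint assignable (ps : seq (nat * nat)) (U : seq (seq nat)) : bool :=
  if ps is (a, b) :: ps' then
    hasl (fun t : seq nat => if (a \in t) && (b \in t) then assignable ps' (rem t U) else false) U
  else true.

Definition triples : seq (seq nat) := [seq t <- sublists (iota 0 5) | size t == 3].

Definition searchable (U : seq (seq nat)) : bool :=
  hasl (fun p => assignable (zip (0 :: p) (rcons p 0)) U) (permutations (iota 1 4)).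

Definition admissible (U : seq (seq nat)) : bool :=
  (4 < size U) && all (fun i => 1 < count (fun t : seq nat => i \in t) U) (iota 0 5).

Lemma searchable5 : all searchable [seq U <- sublists triples | admissible U].
Proof. by vm_compute. Qed.

Lemma triples_ext : all (fun t : seq nat => all (fun u : seq nat => all (fun i => (i \in t) == (i \in u)) (iota 0 5) ==> (t == u)) triples) triples.
Proof. by vm_compute. Qed.

Lemma assignableP ps U : uniq U -> assignable ps U -> exists ts,
  [/\ size ts = size ps, uniq ts, {subset ts <= U}
    & all (fun q : (nat * nat) * seq nat => (q.1.1 \in q.2) && (q.1.2 \in q.2)) (zip ps ts)].
Proof.
elim: ps U => [|[a b] ps IH] U uU /=; first by exists [::].
rewrite haslE => /hasP[t tU]; case: ifP => // /andP[at_ bt] /(IH _ (rem_uniq t uU))[ts [sz uts sub ok]].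
exists (t :: ts); split; rewrite /= ?sz ?at_ ?bt //.
  rewrite uts andbT; apply/negP => /sub; by rewrite mem_rem_uniq // !inE eqxx.
move=> u; rewrite inE => /orP[/eqP->//|/sub]; exact: mem_rem.
Qed.

Section Dense.
Variable V : finType.
Implicit Types (x v : V) (X : {set V}) (E : {set {set V}}) (e g : {set V}).

(** There are at most 1024 systems of triples on five points, so the case is settled by computation; the proof
    transports the system E to the points 0, ..., 4 along the enumeration of X and a solution back. *)
Lemma ham_five X E : #|X| = 5 -> E \subset rsets X 3 -> 5 <= #|E| ->
  (forall x, x \in X -> 1 < #|star E x|) -> hamiltonian X E.
Proof.
move=> X5 EX E5 dE.
have /card_gt0P[x0 x0X] : 0 < #|X| by rewrite X5.
pose f i := nth x0 (enum X) i.
have fX : map f (iota 0 5) = enum X.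
  by rewrite -[RHS](mkseq_nth x0) -cardE X5.
have f_inj i j : i < 5 -> j < 5 -> f i = f j -> i = j.
  by move=> i5 j5 /eqP; rewrite nth_uniq ?enum_uniq -?cardE ?X5 // => /eqP.
pose F (t : seq nat) : {set V} := [set x in map f t].
have t5 t i : t \in triples -> i \in t -> i < 5.
  by rewrite mem_filter => /andP[_ /sublists_subset sub] /sub; rewrite mem_iota.
have fF t i : t \in triples -> i < 5 -> (f i \in F t) = (i \in t).
  move=> tT i5; rewrite inE; apply/mapP/idP => [[j jt /f_inj]|it]; last by exists i.
  by move=> -> //; apply: t5 jt.
have F_inj : {in triples &, injective F}.
  move=> t u tT uT eF; apply/eqP.
  apply: (implyP (allP (allP triples_ext t tT) u uT)).
  by apply/allP=> i; rewrite mem_iota => /= i5; rewrite -!fF // eF.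
have F_surj e : e \in E -> exists2 t, t \in triples & e = F t.
  move=> eE; have [eX ce] := mem_rsets EX eE.
  pose t := [seq i <- iota 0 5 | f i \in e].
  have ft : map f t = filter (mem e) (enum X) by rewrite -fX filter_map.
  exists t; last first.
    apply/setP=> x; rewrite inE ft mem_filter mem_enum /=.
    by case xe: (x \in e) => //; rewrite (subsetP eX).
  rewrite mem_filter filter_sublists andbT -(size_map f) ft size_filter -ce cardE /enum_mem.
  rewrite -size_filter -filter_predI; apply/eqP; congr size; apply: eq_filter => x /=.
  by apply: andb_idr => /(subsetP eX).
pose U := [seq t <- triples | F t \in E].
have UT t : t \in U -> t \in triples /\ F t \in E by rewrite mem_filter => /andP[].
have uU : uniq U by apply: filter_uniq; vm_compute.
have EU (P : pred (seq nat)) (A : {set {set V}}) :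
    (forall t, t \in U -> F t \in A -> P t) -> A \subset E -> #|A| <= count P U.
  move=> PA AE; rewrite -size_filter -(size_map F) cardE; apply: uniq_leq_size; first exact: enum_uniq.
  move=> e; rewrite mem_enum => eA; have [t tT et] := F_surj e (subsetP AE _ eA).
  have tU : t \in U by rewrite mem_filter tT -et (subsetP AE).
  by rewrite et map_f // mem_filter tU PA // -et.
have : searchable U.
  apply: (allP searchable5); rewrite mem_filter filter_sublists andbT; apply/andP; split.
    by rewrite -(count_predT U); apply: leq_trans E5 _; apply: EU.
  apply/allP=> i; rewrite mem_iota => /= i5.
  have fiX : f i \in X by rewrite -mem_enum mem_nth // -cardE X5.
  apply: leq_trans (dE _ fiX) _; apply: EU => [t tU|]; last first.
    by apply/subsetP=> e; rewrite inE => /andP[].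
  by rewrite inE fF // ?(UT t tU).1 // => /andP[].
rewrite /searchable haslE => /hasP[p]; rewrite mem_permutations => p_perm /(assignableP uU)[ts [sz uts sub ok]].
have pX : perm_eq (map f (0 :: p)) (enum X).
  by rewrite -fX; apply: perm_map; rewrite /= perm_cons.
have sp : size p = 4 by rewrite (perm_size p_perm).
have p5 i : i \in 0 :: p -> i < 5.
  have : perm_eq (0 :: p) (iota 0 5) by rewrite perm_cons.
  by move/perm_mem=> ->; rewrite mem_iota.
have inF t i : t \in ts -> i \in 0 :: p -> i \in t -> f i \in F t.
  by move=> tt ip it; rewrite fF ?p5 // (UT t (sub _ tt)).1.
have uF : uniq (map F ts).
  by rewrite map_inj_in_uniq // => t u /sub/UT[tT _] /sub/UT[uT _]; apply: F_inj.
have EF t : t \in ts -> F t \in E by move=> /sub/UT[].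
have up : uniq (map f (0 :: p)) by rewrite (perm_uniq pX) enum_uniq.
have mp : map f (0 :: p) =i X by move=> x; rewrite (perm_mem pX) mem_enum.
case: p sp {p_perm pX p5} sz ok inF up mp => [|b [|c [|d [|e [|]]]]] // _.
case: ts {uts sub} uF EF => [|t0 [|t1 [|t2 [|t3 [|t4 [|]]]]]] // uF EF _ /=.
move=> /and5P[/andP[a0 b0] /andP[b1 c1] /andP[c2 d2] /andP[d3 e3] /andP[/andP[e4 a4] _]] inF up mp.
have {}inF t i : t \in [:: t0; t1; t2; t3; t4] -> i \in [:: 0; b; c; d; e] -> i \in t -> (f i \in F t) = true.
  by move=> *; apply: inF.
exists [:: inl (f 0); inr (F t0); inl (f b); inr (F t1); inl (f c); inr (F t2); inl (f d); inr (F t3);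
           inl (f e); inr (F t4)]; split.
  by rewrite /= !inF // !inE eqxx ?orbT.
apply: (@spans_perm _ _ _ (map inl (map f [:: 0; b; c; d; e]) ++ map inr (map F [:: t0; t1; t2; t3; t4]))).
  by apply/seq.permP=> P /=; do 10?case: (P _).
split.
- have injl : injective (@inl V {set V}) by move=> ? ? [].
  have injr : injective (@inr V {set V}) by move=> ? ? [].
  rewrite cat_uniq (map_inj_uniq injl) (map_inj_uniq injr); apply/and3P; split; [exact: up| |exact: uF].
  apply/hasPn=> z /mapP[g _ ->]; apply/mapP=> -[//].
- move=> x; rewrite mem_cat mem_map; last by move=> ? ? [].
  by rewrite mp; case: (x \in X) => //=; apply/mapP=> -[].
move=> g; rewrite mem_cat => /orP[/mapP[]//|].
by rewrite mem_map; [case/mapP=> t tt ->; apply: EF|move=> ? ? []].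
Qed.

(** * Dense hypergraphs of minimum degree two *)

(** The case r = |X| - 2, where deleting a vertex is useless because too few edges avoid it. *)
Lemma ham_base X E : 5 <= #|X| -> E \subset rsets X (#|X| - 2) -> #|X| <= #|E| ->
  (forall x, x \in X -> 1 < #|star E x|) -> hamiltonian X E.
Proof.
have [n] := ubnP #|X|; elim: n => // n IH in X E *; rewrite ltnS => Xn X5 EX XE dE.
have [X6|] := ltnP 5 #|X|.
  apply: base_step => // X' E' cX EX' XE' dE'; apply: IH => //; rewrite cX; clear -X6 Xn; lia.
move=> X5'; have cX : #|X| = 5 by apply/eqP; rewrite eqn_leq X5 X5'.
by apply: ham_five => //; rewrite cX in EX XE.
Qed.

(** Under the bound on |E|, minimum degree two is all that is needed. A deleted vertex leaves an excess of at
    least two edges, so that the minimum degree condition comes for free in the induction. *)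
Lemma ham_dense X E r : 2 < r -> r + 2 <= #|X| -> E \subset rsets X r -> 'C(#|X|.-1, r) < #|E| ->
  (forall x, x \in X -> 1 < #|star E x|) -> hamiltonian X E.
Proof.
move=> r3; have [n] := ubnP #|X|; elim: n => // n IH in X E *; rewrite ltnS => Xn Xr EX cE dE.
have [X3|] := ltnP (r + 2) #|X|; last first.
  move=> X3; have eX : #|X| = r + 2 by apply/eqP; rewrite eqn_leq X3 Xr.
  apply: ham_base => //; first by clear -r3 eX; lia.
    by rewrite eX addnK.
  by move: cE; rewrite eX addn2 /= binSn.
have Xr3 : r + 3 <= #|X| by clear -X3; lia.
have [v vX cv] := exists_deletion r3 Xr3 EX cE.
have cX : #|X :\ v| = #|X|.-1 by rewrite (cardsD1 v X) vX.
have EX' := avoiding_rsets v EX.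
have [s sH] : hamiltonian (X :\ v) (avoiding E v).
  apply: IH => //; rewrite ?cX; [clear -Xn X3; lia|clear -X3; lia|clear -cv; lia|].
  by move=> x xX; apply: avoiding_mindeg EX' xX _; rewrite cX.
exact: ham_delete r3 Xr3 EX vX cE (dE v vX) sH.
Qed.

End Dense.

(** * Indexed cycles and paths *)

Section Translate.
Variable V : finType.
Implicit Types (x y v : V) (E : {set {set V}}).

Section Round.
Variables (E : {set {set V}}) (s : seq (V + {set V})).
Hypothesis sH : ham_cycle [set: V] E s.
Let f := next_vertex s.

Lemma next_injT : injective f.
Proof. by move=> y z; apply: (next_vertex_inj sH); rewrite inE. Qed.

Lemma no_short_cycleT k y : 0 < k < #|V| -> iter k f y != y.
Proof. by move=> kV; apply: (no_short_cycle sH); rewrite ?inE ?cardsT. Qed.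

(** The orbit of x has at most |V| elements and, by no_short_cycle, no fewer. *)
Lemma iter_next_card x : iter #|V| f x = x.
Proof.
have oV : order f x <= #|V| by apply: max_card.
have := iter_order next_injT x; have [<- //|ne] := eqVneq (order f x) #|V|.
by move/eqP; rewrite (negPf (no_short_cycleT _ _)) // order_gt0 ltn_neqAle ne.
Qed.

Lemma round_inj x : injective (fun i : 'I_#|V| => iter i f x).
Proof.
have half (i j : 'I_#|V|) : i < j -> iter i f x != iter j f x.
  move=> ij; rewrite eq_sym -(subnK (ltnW ij)) iterD; apply: no_short_cycleT.
  by have := ltn_ord j; clear -ij; lia.
move=> i j e; apply/val_inj; case: (ltngtP i j) => // ij.
  by have := half _ _ ij; rewrite e eqxx.
by have := half _ _ ij; rewrite e eqxx.
Qed.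

Lemma round_surj x y : exists i : 'I_#|V|, iter i f x = y.
Proof.
have leV : #|V| <= #|'I_#|V| | by rewrite card_ord.
by have [g _ gK] := inj_card_bij (@round_inj x) leV; exists (g y); rewrite gK.
Qed.

End Round.

(** In the target definition edge i precedes vertex i, hence the shift by ord_pred. *)
Lemma has_cycle_of_hamiltonian r (H : hypergraph r V) (x : V) :
  hamiltonian [set: V] (edges H) -> has_hamiltonian_berge_cycle H.
Proof.
case=> s sH; set f := next_vertex s.
pose vv (i : 'I_#|V|) := iter i f x.
pose ee (i : 'I_#|V|) := next_edge s (vv (ord_pred i)).
have step i : vv (ordS i) = f (vv i).
  rewrite /vv /= -iterS; have [lt|ge] := ltnP i.+1 #|V|; first by rewrite modn_small.
  have -> : i.+1 = #|V| by apply/eqP; rewrite eqn_leq ge ltn_ord.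
  by rewrite modnn (iter_next_card sH).
exists #|V|, vv, ee; split; last exact: round_surj sH x.
split.
- exact: round_inj sH x.
- move=> i j /(next_edge_inj sH); rewrite !inE => /(_ isT isT).
  by move/(round_inj sH)/(can_inj (@ord_predK _)).
- by move=> i; apply: (next_edge_in sH (in_setT (vv (ord_pred i)))).
move=> i; rewrite inE /ee ordSK.
have [-> _] := next_incident sH (in_setT (vv i)).
have [_] := next_incident sH (in_setT (vv (ord_pred i))).
by rewrite -/f -step ord_predK andbT.
Qed.

(** The cycle is opened at g, or anywhere if it does not use g. *)
Lemma has_path_of_hamiltonian r (H : hypergraph r V) (g : {set V}) (x0 : V) :
  hamiltonian [set: V] (g |: edges H) -> has_hamiltonian_berge_path H.
Proof.
case=> s sH; set f := next_vertex s.
have [b gb] : exists b, forall x, next_edge s x = g -> x = b.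
  have [/existsP[b /eqP eb]|] := boolP [exists b, next_edge s b == g].
    by exists b => x e; apply: (next_edge_inj sH); rewrite ?inE // e eb.
  by rewrite negb_exists => /forallP ng; exists x0 => x /eqP; rewrite (negPf (ng x)).
pose vv (i : 'I_#|V|) := iter i f (f b).
have lt1 (i : 'I_(#|V|.-1)) : i < #|V| by apply: leq_trans (ltn_ord i) (leq_pred _).
pose ee (i : 'I_(#|V|.-1)) := next_edge s (iter i f (f b)).
exists #|V|, vv, ee; split; last exact: round_surj sH _.
split.
- exact: round_inj sH _.
- move=> i j /(next_edge_inj sH); rewrite !inE => /(_ isT isT) e; apply: val_inj.
  by have := round_inj sH (x1 := Ordinal (lt1 i)) (x2 := Ordinal (lt1 j)) e => -[].
- move=> i; have := next_edge_in sH (in_setT (iter i f (f b))); rewrite in_setU1.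
  case/orP=> [/eqP /gb|//]; rewrite -iterSr => /eqP.
  by rewrite (negPf (no_short_cycleT sH _ _)) //= -ltn_predRL.
move=> i j k ij ik; rewrite /vv ij ik iterS subUset !sub1set.
by have [-> ->] := next_incident sH (in_setT (iter i f (f b))).
Qed.

(** * The exceptional hypergraphs *)

Lemma exists_bij_option m x : #|V| = m.+1 -> exists2 h : V -> option 'I_m, bijective h & h x = None.
Proof.
move=> cV; have cE : #|V| = #|{: option 'I_m}| by rewrite card_option card_ord.
pose h0 y := enum_val (cast_ord cE (enum_rank y)).
exists (fun y => tperm (h0 x) None (h0 y)); last by rewrite tpermL.
exists (fun z => enum_val (cast_ord (esym cE) (enum_rank (tperm (h0 x) None z)))) => y.
  by rewrite tpermK /h0 enum_valK cast_ordK enum_rankK.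
by rewrite /h0 enum_valK cast_ordKV enum_rankK tpermK.
Qed.

Lemma mem_add_vertex_complete r m (h : V -> option 'I_m) x (A : {set V}) : bijective h -> h x = None ->
  (h @: A \in edges (add_vertex (complete r 'I_m))) = (A \in rsets ([set: V] :\ x) r).
Proof.
move=> h_bij hx; have h_inj := bij_inj h_bij.
rewrite inE subsetD1 subsetT /= -(card_imset _ h_inj).
apply/imsetP/andP=> [[B]|[xA cA]].
  rewrite inE => /eqP cB eB; rewrite eB card_imset; last by move=> ? ? [].
  rewrite cB eqxx; split=> //; apply/negP=> xA.
  have : h x \in h @: A by apply: imset_f.
  by rewrite eB hx => /imsetP[].
have eA : h @: A = Some @: [set i | Some i \in h @: A].
  apply/setP=> -[i|].
    by rewrite mem_imset ?inE // => ? ? [].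
  transitivity false; last by apply/esym/imsetP=> -[].
  by rewrite -hx (mem_imset _ _ h_inj); apply: negbTE.
exists [set i | Some i \in h @: A] => //.
have Some_inj : injective (@Some 'I_m) by move=> ? ? [].
by rewrite inE -(card_imset _ Some_inj) -eA.
Qed.

End Translate.

Section Exceptions.
Variables (r n : nat) (V : finType) (H : hypergraph r V).
Hypotheses (hr : 3 <= r) (hn : r + 2 <= n) (hV : #|V| = n).

Let card_V : #|[set: V]| = n. Proof. by rewrite cardsT. Qed.

Lemma edges_rsets : edges H \subset rsets [set: V] r.
Proof. by apply/subsetP=> e eH; rewrite inE subsetT (edges_uniform eH) eqxx. Qed.

Lemma card_setD1T (x : V) : #|[set: V] :\ x| = n - 1.
Proof. by rewrite -card_V (cardsD1 x [set: V]) in_setT addKn. Qed.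

Lemma avoiding_full x : 'C(n - 1, r) <= #|avoiding (edges H) x| ->
  avoiding (edges H) x = rsets ([set: V] :\ x) r.
Proof.
move=> c; apply/eqP; rewrite eqEcard (avoiding_rsets _ edges_rsets) /=.
by rewrite card_rsets card_setD1T.
Qed.

Lemma exists_bij (x : V) : exists2 h : V -> option 'I_(n - 1), bijective h & h x = None.
Proof. by apply: exists_bij_option; rewrite hV; clear -hn; lia. Qed.

(** An edgeless vertex leaves room for C(n-1, r) edges only, so all of them are present. *)
Lemma isolated_exception x : 'C(n - 1, r) <= #|edges H| -> #|star (edges H) x| = 0 ->
  is_complete_plus_vertex H (n - 1).
Proof.
move=> c d0; have full := @avoiding_full x; have [h h_bij hx] := exists_bij x.
exists h => // A; rewrite (mem_add_vertex_complete _ _ h_bij hx) -full; last first.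
  by have := card_star_avoiding (edges H) x; rewrite d0 add0n => ->.
rewrite inE; case AH: (A \in edges H) => //=; apply/esym/negP => xA.
by have := cards0_eq d0; move/setP/(_ A); rewrite !inE AH xA.
Qed.

(** Beyond the single edge through x there is room for C(n-1, r) edges only, so all of them are present. *)
Lemma pendant_exception x : 'C(n - 1, r) < #|edges H| -> #|star (edges H) x| <= 1 ->
  is_complete_plus_edge H (n - 1).
Proof.
move=> c d1; have sa := card_star_avoiding (edges H) x.
have a_le := card_rsets_le (avoiding_rsets x edges_rsets); rewrite card_setD1T in a_le.
have /eqP/cards1P[e0 def_e0] : #|star (edges H) x| = 1 by clear -c d1 sa a_le; lia.
have full : avoiding (edges H) x = rsets ([set: V] :\ x) r.
  by apply: avoiding_full; clear -c d1 sa; lia.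
have [h h_bij hx] := exists_bij x; have h_inj := bij_inj h_bij.
have : e0 \in star (edges H) x by rewrite def_e0 set11.
rewrite inE => /andP[e0H xe0].
have er : #|h @: e0| = r by rewrite card_imset // (edges_uniform e0H).
exists (h @: e0), er; split; first by rewrite -hx imset_f.
exists h => // A; rewrite in_setU1 (mem_add_vertex_complete _ _ h_bij hx) -full inE.
rewrite (inj_eq (imset_inj h_inj)).
have [->|Ae0] := eqVneq A e0; first by rewrite e0H.
case AH: (A \in edges H) => //=; apply/esym/negP => xA.
by have := set11 e0; move/setP/(_ A): def_e0; rewrite !inE AH xA (negPf Ae0).
Qed.

Lemma card_star_rsets (x : V) : #|star (rsets [set: V] r) x| = 'C(n - 1, r - 1).
Proof.
have [k ->] : exists k, r = k.+1 by exists r.-1; rewrite prednK //; clear -hr; lia.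
by rewrite subn1 card_rsets_at ?in_setT // card_V subn1.
Qed.

(** Adding a well-chosen non-edge makes ham_dense applicable. An isolated vertex is excluded by the exception;
    if x has degree one, the new edge is taken through x, and the other degrees are large because at most
    one r-set avoiding x is missing. *)
Lemma exists_new_edge : 'C(n - 1, r) <= #|edges H| -> ~ is_complete_plus_vertex H (n - 1) ->
  exists2 g : {set V}, #|g| = r & hamiltonian [set: V] (g |: edges H).
Proof.
move=> c noexc.
have dense (E : {set {set V}}) : E \subset rsets [set: V] r -> 'C(n - 1, r) < #|E| ->
    (forall x, 1 < #|star E x|) -> hamiltonian [set: V] E.
  move=> EX cE dE; apply: (@ham_dense _ _ _ r) => //; rewrite card_V //.
  by rewrite -subn1.
have addP (g : {set V}) : #|g| = r -> g |: edges H \subset rsets [set: V] r.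
  by move=> cg; rewrite subUset edges_rsets sub1set inE subsetT cg eqxx.
have d1 x : 0 < #|star (edges H) x|.
  rewrite lt0n; apply/negP=> /eqP d0; apply: noexc; exact: isolated_exception d0.
have [/existsP[x dx]|] := boolP [exists x, #|star (edges H) x| == 1].
  have : ~~ (star (rsets [set: V] r) x \subset star (edges H) x).
    apply/negP=> /subset_leq_card; rewrite card_star_rsets (eqP dx) leqNgt => /negP; apply.
    by apply: leq_trans (leq_bin _); clear -hr hn; lia.
  case/subsetPn=> g; rewrite !inE => /andP[/andP[_ /eqP cg] xg]; rewrite xg andbT => gH.
  exists g => //; apply: dense; first exact: addP.
    rewrite cardsU1 gH; clear -c; lia.
  move=> w; have [->|wx] := eqVneq w x.
    have -> : star (g |: edges H) x = g |: star (edges H) x.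
      by apply/setP=> e; rewrite !inE andb_orl; case: eqVneq => // ->; rewrite xg.
    by rewrite cardsU1 (eqP dx) inE (negPf gH).
  apply: leq_trans (star_sub w (subsetUr _ _)).
  have sub : avoiding (edges H) x \subset edges H by apply/subsetP=> e; rewrite inE => /andP[].
  apply: leq_trans (star_sub w sub).
  have h1 := card_star_avoiding (edges H) x.
  have h2 := card_star_avoiding (avoiding (edges H) x) w.
  have h3 := card_rsets_le (avoiding_rsets w (avoiding_rsets x edges_rsets)).
  have cX : #|[set: V] :\ x :\ w| = n - 2.
    have := cardsD1 w ([set: V] :\ x); rewrite card_setD1T in_setD1 wx in_setT /=; clear -hn; lia.
  have h4 : n - 2 <= 'C(n - 2, r - 1) by apply: leq_bin; clear -hr hn; lia.
  have h5 : 'C(n - 1, r) = 'C(n - 2, r) + 'C(n - 2, r - 1).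
    have -> : n - 1 = (n - 2).+1 by clear -hn; lia.
    have [k ->] : exists k, r = k.+1 by exists r.-1; clear -hr; lia.
    by rewrite binS subn1.
  rewrite cX in h3; rewrite (eqP dx) in h1; clear -h1 h2 h3 h4 h5 c hr hn; lia.
rewrite negb_exists => /forallP d2'.
have d2 x : 1 < #|star (edges H) x| by rewrite ltn_neqAle eq_sym d2' d1.
have [c'|c'] := ltnP 'C(n - 1, r) #|edges H|.
  have [e eH] : exists e, e \in edges H by apply/card_gt0P; clear -c'; lia.
  exists e; first exact: edges_uniform eH.
  have -> : e |: edges H = edges H by apply/setUidPr; rewrite sub1set.
  exact: dense edges_rsets c' d2.
have : ~~ (rsets [set: V] r \subset edges H).
  apply/negP=> /subset_leq_card; rewrite card_rsets card_V leqNgt => /negP; apply.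
  apply: leq_ltn_trans c' _.
  have [m en] : exists m, n = m.+1 by exists n.-1; clear -hn; lia.
  have [k er] : exists k, r = k.+1 by exists r.-1; clear -hr; lia.
  rewrite en er subn1 binS -[X in X < _]addn0 ltn_add2l bin_gt0; clear -hn en er; lia.
case/subsetPn=> g; rewrite inE => /andP[_ /eqP cg] gH.
exists g => //; apply: dense; first exact: addP.
  by rewrite cardsU1 gH; clear -c; lia.
by move=> x; apply: leq_trans (star_sub x (subsetUr _ _)).
Qed.

End Exceptions.

Theorem theorem3 (r n : nat) (V : finType) (H : hypergraph r V)
    (hr : 3 <= r) (hn : r + 2 <= n) (hV : #|V| = n) :
  ('C(n - 1, r) <= #|edges H| ->
     ~ is_complete_plus_vertex H (n - 1) -> has_hamiltonian_berge_path H)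
  /\
  ('C(n - 1, r) < #|edges H| ->
     ~ is_complete_plus_edge H (n - 1) -> has_hamiltonian_berge_cycle H).
Proof.
have /card_gt0P[x0 _] : 0 < #|V| by rewrite hV; clear -hn; lia.
split=> [c noexc|c noexc].
  have [g _ ham] := exists_new_edge hr hn hV c noexc.
  exact: has_path_of_hamiltonian x0 ham.
apply: (has_cycle_of_hamiltonian x0); apply: (@ham_dense _ _ _ r) => //.
- by rewrite cardsT hV.
- exact: edges_rsets.
- by rewrite cardsT hV -subn1.
move=> x _; rewrite ltnNge; apply/negP => dx; apply: noexc.
exact: (pendant_exception hn hV c dx).
Qed.
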